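(* Let $K$ be a nontrivial complete valued field. Suppose that $W$ is an integral algebraic scheme over $K$ with $\dim W>0$. If $x\in W(K)$ is a smooth point of $W$, then every $K$-analytic neighborhood of $x$ in $W(K)$ is dense in $W(\overline K)$ with respect to the Zariski topology over $\overline K$.
   Context: A nontrivial complete valued field is a field $K$ complete with respect to a nontrivial absolute value (archimedean or non-archimedean). An algebraic scheme over $K$ is a scheme of finite type over $K$. $\overline K$ is an algebraic closure of $K$. A $K$-analytic neighborhood of $x$ in $W(K)$ is a neighborhood of $x$ for the topology on $W(K)$ induced by the absolute value of $K$ (the subspace topology from $K^r$ on affine charts $W\supseteq U\hookrightarrow\mathbf A^r_K$). *)

(* Defs.v *)
From HB Require Import structures.
From mathcomp Require Import all_boot all_order all_algebra.
From mathcomp Require Import boolp classical_sets functions reals topology.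
From mathcomp Require Import -(notations) mpoly.

Set Implicit Arguments.
Unset Strict Implicit.
Unset Printing Implicit Defensive.

Import Order.TTheory GRing.Theory Num.Theory.
Local Open Scope classical_set_scope.
Local Open Scope ring_scope.

(* The notations of [mpoly] clash with those of the analysis library. *)
Notation poly_ring K r := (mpoly r K).

Record absolute_value (R : realType) (K : fieldType) := AbsoluteValue {
  absval :> K -> R;
  absval_ge0 : forall x, 0 <= absval x;
  absval_eq0 : forall x, absval x = 0 <-> x = 0;
  absvalM : forall x y, absval (x * y) = absval x * absval y;
  absvalD : forall x y, absval (x + y) <= absval x + absval y
}.

Section AbsoluteValue.
Context (R : realType) (K : fieldType) (v : absolute_value R K).

Definition av_nontrivial := exists x : K, x != 0 /\ v x != 1.

Definition av_cauchy (u : nat -> K) := forall e : R, 0 < e ->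
  exists N, forall m n, (N <= m)%N -> (N <= n)%N -> v (u m - u n) < e.

Definition av_converges (u : nat -> K) (l : K) := forall e : R, 0 < e ->
  exists N, forall n, (N <= n)%N -> v (u n - l) < e.

Definition av_complete := forall u, av_cauchy u -> exists l, av_converges u l.

(* The product topology on K^r. *)
Definition av_open r (B : set ('I_r -> K)) := forall p, B p ->
  exists2 e : R, 0 < e &
    forall q : 'I_r -> K, (forall i, v (q i - p i) < e) -> B q.

End AbsoluteValue.

Record opens (X : topologicalType) := Opens {
  open_set :> X -> Prop;
  open_setP : open open_set
}.

(* Sections over the empty set form the zero ring, hence [comPzRingType].     *)
(* A morphism to Spec K is the same thing as a compatible K-algebra structure *)
(* on the rings of sections, here given by [rs_coef].                         *)
Record ringed_space (K : fieldType) := RingedSpace {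
  rs_space :> topologicalType;
  rs_sec : opens rs_space -> comPzRingType;
  rs_coef : forall U, {rmorphism K -> rs_sec U};
  rs_res : forall U V : opens rs_space, V `<=` U ->
    {rmorphism rs_sec U -> rs_sec V};
  rs_res_coef : forall (U V : opens rs_space) (VU : V `<=` U) c,
    rs_res VU (rs_coef U c) = rs_coef V c;
  rs_res_id : forall (U : opens rs_space) (UU : U `<=` U) s, rs_res UU s = s;
  rs_res_comp : forall (U V O : opens rs_space)
      (VU : V `<=` U) (OV : O `<=` V) (OU : O `<=` U) s,
    rs_res OV (rs_res VU s) = rs_res OU s;
  rs_glue : forall (U : opens rs_space) (I : Type) (V : I -> opens rs_space)
      (VU : forall i, V i `<=` U) (s : forall i, rs_sec (V i)),
    U `<=` \bigcup_i V i ->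
    (forall i j (O : opens rs_space) (Oi : O `<=` V i) (Oj : O `<=` V j),
       rs_res Oi (s i) = rs_res Oj (s j)) ->
    exists! t : rs_sec U, forall i, rs_res (VU i) t = s i
}.

Section CommutativeAlgebra.

Definition prime_ideal (A : comPzRingType) (P : set A) :=
  [/\ P 0,
      forall a b, P a -> P b -> P (a + b),
      forall a b, P b -> P (a * b),
      ~ P 1 &
      forall a b, P (a * b) -> P a \/ P b].

(* [f : A -> B] exhibits B as A[1/s]. *)
Definition is_localization (A B : comPzRingType) (s : A)
    (f : {rmorphism A -> B}) :=
  [/\ exists t, f s * t = 1,
      forall b, exists a n, b * f s ^+ n = f a &
      forall a, f a = 0 -> exists n, s ^+ n * a = 0].

Definition is_domain (A : comPzRingType) :=
  (1 : A) <> 0 /\ forall a b : A, a * b = 0 -> a = 0 \/ b = 0.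

Context (K : fieldType) (A : comPzRingType) (i : {rmorphism K -> A}).

(* p(a_1, ..., a_r); [mmap] does not allow the zero ring as a target. *)
Definition peval r (a : 'I_r -> A) (p : poly_ring K r) : A :=
  \sum_(m <- msupp p)
     i (mcoeff m p) *
     \prod_(j < r) a j ^+ fun_of_multinom m j.

Definition generates r (a : 'I_r -> A) := forall s, exists p, peval a p = s.

(* A = K[T_1, ..., T_r] / (g_1, ..., g_c), with T_j mapped to a_j. *)
Definition is_presentation r c (a : 'I_r -> A) (g : 'I_c -> poly_ring K r) :=
  generates a /\
  forall p, peval a p = 0 <->
    exists q : 'I_c -> poly_ring K r, p = \sum_(k < c) q k * g k.

End CommutativeAlgebra.

Section Scheme.
Context (K : fieldType).

(* (U, O_U) is isomorphic to Spec A for A = O(U), i.e. [phi] is a             *)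
(* homeomorphism from U to the set of primes of A with the Zariski topology,  *)
(* and the sections over each principal open D(s) form the localization       *)
(* A[1/s]; since the D(s) are a base, this determines the structure sheaf.    *)
Definition is_affine (X : ringed_space K) (U : opens X) :=
  exists phi : X -> set (rs_sec U),
  [/\ forall x, U x -> prime_ideal (phi x),
      forall x y, U x -> U y -> phi x = phi y -> x = y,
      forall P, prime_ideal P -> exists2 x, U x & phi x = P,
      forall V : set X, V `<=` U ->
        (open V <-> exists S : set (rs_sec U),
           V = [set x | U x /\ exists2 s, S s & ~ phi x s]) &
      forall (s : rs_sec U) (V : opens X) (VU : V `<=` U),
        V = [set x | U x /\ ~ phi x s] :> set X ->
        is_localization s (rs_res VU)].

Record scheme := Scheme {
  scheme_rs :> ringed_space K;
  scheme_affine : forall x : scheme_rs,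
    exists2 U : opens scheme_rs, U x & is_affine U
}.

(* A closed immersion of the affine open U into affine r-space. *)
Definition is_chart (W : scheme) (U : opens W) r (a : 'I_r -> rs_sec U) :=
  is_affine U /\ generates (rs_coef U) a.

Definition finite_type (W : scheme) :=
  exists n (U : 'I_n -> opens W),
    (forall x, exists k, U k x) /\
    (forall k, exists r (a : 'I_r -> rs_sec (U k)), is_chart a).

Definition integral_scheme (W : scheme) :=
  (exists x : W, True) /\
  forall U : opens W, U !=set0 -> is_domain (rs_sec U).

Definition irreducible_subset (X : topologicalType) (Z : set X) :=
  Z !=set0 /\
  forall A B, closed A -> closed B -> Z `<=` A `|` B -> Z `<=` A \/ Z `<=` B.

(* dim X >= n *)
Definition krull_dim_ge (X : topologicalType) (n : nat) :=
  exists Z : nat -> set X,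
    (forall k, (k <= n)%N -> closed (Z k) /\ irreducible_subset (Z k)) /\
    (forall k, (k < n)%N -> Z k `<` Z k.+1).

(* W(L): morphisms of locally ringed spaces Spec L -> W over K, where L is a  *)
(* K-algebra through [i]. Such a morphism is a point together with a local    *)
(* homomorphism from the stalk at this point to L, given here on sections.    *)
Record points (L : fieldType) (i : {rmorphism K -> L}) (W : scheme) := Point {
  pt : W;
  ev : forall U : opens W, U pt -> {rmorphism rs_sec U -> L};
  ev_coef : forall (U : opens W) (Ux : U pt) c, ev Ux (rs_coef U c) = i c;
  ev_res : forall (U V : opens W) (VU : V `<=` U) (Ux : U pt) (Vx : V pt) s,
    ev Vx (rs_res VU s) = ev Ux s;
  ev_local : forall (U : opens W) (Ux : U pt) s, ev Ux s != 0 ->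
    exists (V : opens W) (VU : V `<=` U), V pt /\
      exists t, rs_res VU s * t = 1
}.

Definition coords (L : fieldType) (i : {rmorphism K -> L}) (W : scheme)
    (y : points i W) (U : opens W) (Uy : U (pt y)) r (a : 'I_r -> rs_sec U) :
  'I_r -> L := fun j => ev Uy (a j).

(* Jacobian criterion as a definition: some affine neighbourhood of x is the  *)
(* zero locus of c polynomials whose Jacobian matrix has rank c at x.         *)
Definition smooth_at (W : scheme) (x : points (idfun : {rmorphism K -> K}) W) :=
  exists (U : opens W) (Ux : U (pt x)) (r c : nat)
         (a : 'I_r -> rs_sec U) (g : 'I_c -> poly_ring K r),
    [/\ is_affine U,
        is_presentation (rs_coef U) a g &
        row_free (\matrix_(k < c, j < r)
          meval (coords Ux a) (mderiv j (g k)))].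

Section ExtendPoint.
Context (L : fieldType) (i : {rmorphism K -> L}) (W : scheme).
Variable y : points (idfun : {rmorphism K -> K}) W.

Let ev' (U : opens W) (Uy : U (pt y)) : {rmorphism rs_sec U -> L} :=
  i \o ev Uy.

Let ev'_coef (U : opens W) (Uy : U (pt y)) c : ev' Uy (rs_coef U c) = i c.
Proof. by rewrite /ev' /= ev_coef. Qed.

Let ev'_res (U V : opens W) (VU : V `<=` U) (Uy : U (pt y)) (Vy : V (pt y)) s :
  ev' Vy (rs_res VU s) = ev' Uy s.
Proof. by rewrite /ev' /= (ev_res VU Uy). Qed.

Let ev'_local (U : opens W) (Uy : U (pt y)) s : ev' Uy s != 0 ->
  exists (V : opens W) (VU : V `<=` U), V (pt y) /\
    exists t, rs_res VU s * t = 1.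
Proof. by rewrite /ev' /= fmorph_eq0; exact: ev_local. Qed.

(* The map W(K) -> W(L). *)
Definition extend_point : points i W := Point ev'_coef ev'_res ev'_local.

End ExtendPoint.

End Scheme.

(* The topology on W(L) for which every affine chart is an open embedding,    *)
(* when the spaces L^r are endowed with the open sets [op].                   *)
Section ChartTopology.
Context (K L : fieldType) (i : {rmorphism K -> L}) (W : scheme K).
Variable op : forall r, set (set ('I_r -> L)).

Definition chart_open (S : set (points i W)) :=
  forall (U : opens W) r (a : 'I_r -> rs_sec U), is_chart a ->
  exists2 B, op B &
    forall (y : points i W) (Uy : U (pt y)), S y <-> B (coords Uy a).

Hypothesis opT : forall r, @op r setT.
Hypothesis opI : forall r, setI_closed (@op r).
Hypothesis op_bigU : forall r (I : Type) (f : I -> set ('I_r -> L)),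
  (forall k, op (f k)) -> op (\bigcup_k f k).

Lemma chart_openT : chart_open setT.
Proof. by move=> U r a _; exists setT. Qed.

Lemma chart_openI : setI_closed chart_open.
Proof.
move=> S T oS oT U r a ch.
have [B oB SB] := oS U r a ch; have [C oC TC] := oT U r a ch.
by exists (B `&` C) => [|y Uy]; [exact: opI | split=> -[/SB ? /TC ?]].
Qed.

Lemma chart_open_bigU (I : Type) (f : I -> set (points i W)) :
  (forall k, chart_open (f k)) -> chart_open (\bigcup_k f k).
Proof.
move=> of_ U r a ch.
have /choice[B BP] : forall k, exists B : set ('I_r -> L), op B /\
    forall (y : points i W) (Uy : U (pt y)), f k y <-> B (coords Uy a).
  by move=> k; have [B ? ?] := of_ k U r a ch; exists B.
exists (\bigcup_k B k) => [|y Uy]; first by apply: op_bigU => k; case: (BP k).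
by split=> -[k _ /(BP k).2 ?]; exists k.
Qed.

End ChartTopology.

(* W(K) with the K-analytic topology given by v. *)
Definition analytic_points (R : realType) (K : fieldType)
    (v : absolute_value R K) (W : scheme K) :=
  points (idfun : {rmorphism K -> K}) W.

Section Analytic.
Context (R : realType) (K : fieldType) (v : absolute_value R K).

Lemma av_openT r : av_open v [set: 'I_r -> K].
Proof. by move=> p _; exists 1. Qed.

Lemma av_openI r : setI_closed (@av_open R K v r).
Proof.
move=> B C oB oC p [/oB[d d0 Bd] /oC[e e0 Ce]].
exists (Num.min d e) => [|q qp]; first by rewrite lt_min d0.
by split; [apply: Bd | apply: Ce] => k; have := qp k; rewrite lt_min => /andP[].
Qed.

Lemma av_open_bigU r (I : Type) (f : I -> set ('I_r -> K)) :
  (forall k, av_open v (f k)) -> av_open v (\bigcup_k f k).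
Proof.
by move=> of_ p [k _ /of_[e e0 fe]]; exists e => // q /fe ?; exists k.
Qed.

Variable W : scheme K.
HB.instance Definition _ := gen_eqMixin (analytic_points v W).
HB.instance Definition _ := gen_choiceMixin (analytic_points v W).
HB.instance Definition _ := isOpenTopological.Build (analytic_points v W)
  (chart_openT idfun av_openT) (chart_openI av_openI)
  (chart_open_bigU av_open_bigU).

End Analytic.

Section Zariski.
Context (L : fieldType).

Definition zariski_open r (B : set ('I_r -> L)) :=
  exists F : set (poly_ring L r),
    B = [set z | exists2 f, F f & meval z f <> 0].

Lemma zariski_openT r : zariski_open [set: 'I_r -> L].
Proof.
exists [set 1]; apply/seteqP; split=> // z _; exists 1 => //.
by rewrite meval1; apply/eqP; exact: oner_neq0.
Qed.

Lemma zariski_openI r : setI_closed (@zariski_open r).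
Proof.
move=> _ _ [F ->] [G ->].
exists [set h | exists f g, [/\ F f, G g & h = f * g]].
apply/seteqP; split=> z.
- move=> [[f Ff /eqP fz] [g Gg /eqP gz]]; exists (f * g); first by exists f, g.
  by rewrite mevalM; apply/eqP; rewrite mulf_neq0.
- move=> [_ [f [g [Ff Gg ->]]]]; rewrite mevalM => /eqP.
  by rewrite mulf_eq0 negb_or => /andP[/eqP ? /eqP ?]; split; [exists f|exists g].
Qed.

Lemma zariski_open_bigU r (I : Type) (f : I -> set ('I_r -> L)) :
  (forall k, zariski_open (f k)) -> zariski_open (\bigcup_k f k).
Proof.
move=> /choice[F fF]; exists (\bigcup_k F k); apply/seteqP; split=> z.
- by move=> [k _]; rewrite fF => -[p Fp pz]; exists p => //; exists k.
- by move=> [p [k _ Fp] pz]; exists k => //; rewrite fF; exists p.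
Qed.

Context (K : fieldType) (i : {rmorphism K -> L}).

(* W(L) with the Zariski topology over L, in which closed sets are locally    *)
(* cut out by polynomials with coefficients in L.                             *)
Definition zariski_points (W : scheme K) := points i W.

Variable W : scheme K.
HB.instance Definition _ := gen_eqMixin (zariski_points W).
HB.instance Definition _ := gen_choiceMixin (zariski_points W).
HB.instance Definition _ := isOpenTopological.Build (zariski_points W)
  (chart_openT i zariski_openT) (chart_openI zariski_openI)
  (chart_open_bigU zariski_open_bigU).

End Zariski.

(* Main.v *)
(* After writing a polynomial over Kbar as a combination, with coefficients   *)

(* A nonempty Zariski open set contains, within a chart, the points where some polynomial f over
   Kbar is nonzero. Expanding its coefficients in a family e_j independent over K gives f = sum_j
   phi_j e_j with sections phi_j over K ([meval_lin_indep]). Some phi_j is nonzero, and f vanishes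
   at a K-point only if every phi_j does. So it suffices to find a K-point in N where a given
   nonzero section does not vanish ([smooth_nonvanishing]). By [integral_meet] the search moves to
   the smooth affine neighbourhood of x. There [nonvanishing_zero] combines three facts: Newton's
   method gives zeros of g near x in every tangent direction ([zeros_along]), a function vanishing
   at them lies in every power of the maximal ideal of x ([vanishing_ideal_max_pow]), and in a
   domain such a function is zero by [krull]. Finally [point_of_rmorphism] turns the zero found into
   a point of W. *)
(* linearly independent over K, of functions defined over K, it remains to    *)
(* see that a nonzero s in the coordinate ring A = K[T]/(g) of a smooth       *)
(* affine neighbourhood of x does not vanish on all zeros of g near           *)
(* p0 = coords x. If it did, then s would lie in every power of the maximal   *)
(* ideal m of x: Newton's method gives zeros of g tangent to any direction in *)
(* the kernel of the Jacobian, so that modulo (g) the leading forms of a lift *)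
(* of s vanish one after the other. By Krull's intersection theorem s = E s   *)
(* with E in m, hence s = 0 as A is a domain.                                 *)
Require Import Defs.
From HB Require Import structures.
From mathcomp Require Import all_boot all_order all_algebra.
From mathcomp Require Import boolp classical_sets reals topology.
From mathcomp Require Import -(notations) mpoly.
From mathcomp Require Import ring lra.

Set Implicit Arguments.
Unset Strict Implicit.
Unset Printing Implicit Defensive.

Import Order.TTheory GRing.Theory Num.Theory.
Local Open Scope classical_set_scope.
Local Open Scope ring_scope.

(** * Polynomial rings *)

Section Polynomials.
Context (K : comNzRingType) (n : nat).
Local Notation KX := (poly_ring K n).
Local Notation X i := (mpolyX K (mnm1 i) : KX).

(** Constants and variables generate the ring, so morphisms, Taylor expansions and estimates are
    checked there and under sums and products. *)
Lemma mpoly_ring_ind (P : KX -> Prop) :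
  (forall c, P (mpolyC n c)) -> (forall i, P (X i)) ->
  (forall p q, P p -> P q -> P (p + q)) ->
  (forall p q, P p -> P q -> P (p * q)) -> forall p, P p.
Proof.
move=> PC PX PD PM; apply: mpolyind => [|c m p _ _ Pp].
  by rewrite -(mpolyC0 n K); apply: PC.
apply: (PD) => //; rewrite -mul_mpolyC; apply: (PM) => //.
rewrite mpolyXE_id; apply: (big_ind P) => [||i _]; [exact: PC|exact: PM|].
 elim: (fun_of_multinom m i) => [|k IH]; first exact: PC.
by rewrite exprS; apply: PM.
Qed.

Lemma mpoly_lift (S : comNzRingType) (f : {rmorphism K -> S}) (h : 'I_n -> S) :
  exists u : {rmorphism KX -> S},
    (forall c, u (mpolyC n c) = f c) /\ (forall i, u (X i) = h i).
Proof.
exists (mmap f h); split=> [c|i] /=; first by rewrite mmapC.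
by rewrite mmapX mmap1U.
Qed.

End Polynomials.

Section Vanishing.
Context (K : idomainType).
Hypothesis K_infinite : forall p : {poly K}, (forall t, p.[t] = 0) -> p = 0.

(** Read [p] as a polynomial in its last variable. Every specialisation of the other variables gives
    the zero polynomial, so the coefficients vanish everywhere and induction applies to them. *)
Lemma mpoly_eq0 n (p : poly_ring K n) : (forall z, meval z p = 0) -> p = 0.
Proof.
elim: n p => [|n IH] p p0.
  have -> : p = mpolyC 0 (meval (fun=> 0) p).
    elim/mpoly_ring_ind: p {p0} => [c|[]//|p q pE qE|p q pE qE].
    - by rewrite mevalC.
    - by rewrite mevalD mpolyCD -pE -qE.
    - by rewrite mevalM mpolyCM -pE -qE.
  by rewrite p0 mpolyC0.
pose h (i : 'I_n.+1) : {poly poly_ring K n} :=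
  if unlift ord_max i is Some j then (mpolyX K (mnm1 j))%:P else 'X.
have [u [uC uX]] := mpoly_lift (polyC \o @mpolyC n K) h.
(* [w] puts the other variables back, so [p] is recovered from [u p]. *)
have [w [wC wX]] := mpoly_lift (@mpolyC n.+1 K)
  (fun i : 'I_n => mpolyX K (mnm1 (lift ord_max i))).
have uK : p = (map_poly w (u p)).[mpolyX K (mnm1 ord_max)].
  elim/mpoly_ring_ind: p {p0} => [c|i|p q pE qE|p q pE qE].
  - by rewrite uC /= map_polyC hornerC /= wC.
  - rewrite uX /h; case: unliftP => [j ->|->].
      by rewrite map_polyC hornerC /= wX.
    by rewrite map_polyX hornerX.
  - by rewrite (rmorphD u) (rmorphD (map_poly w)) hornerD -pE -qE.
  - by rewrite (rmorphM u) (rmorphM (map_poly w)) hornerM -pE -qE.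
have uE z t : (map_poly (meval z) (u p)).[t] =
    meval (fun i => if unlift ord_max i is Some j then z j else t) p.
  elim/mpoly_ring_ind: p {p0 uK} => [c|i|p q pE qE|p q pE qE].
  - by rewrite uC /= map_polyC hornerC /= !mevalC.
  - rewrite uX mevalXU /h; case: unliftP => [j _|_].
      by rewrite map_polyC hornerC /= mevalXU.
    by rewrite map_polyX hornerX.
  - by rewrite (rmorphD u) (rmorphD (map_poly (meval z))) hornerD mevalD pE qE.
  - by rewrite (rmorphM u) (rmorphM (map_poly (meval z))) hornerM mevalM pE qE.
rewrite uK; suff -> : u p = 0 by rewrite rmorph0 horner0.
apply/polyP => k; rewrite coef0; apply: IH => z.
rewrite -(coef_map (meval z)) [map_poly _ _](K_infinite _) ?coef0 // => t.
by rewrite uE.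
Qed.

End Vanishing.

(** * Hilbert's basis theorem *)

Section Noetherian.

(** The ascending chain condition in the form needed by [krull], without ideals as objects. *)
Definition noetherian (A : comPzRingType) := forall f : nat -> A,
  exists k (q : nat -> A), f k = \sum_(i < k) q i * f i.

(** After each index choose one where the remaining sequence attains its minimum, and iterate. *)
Lemma nondecreasing_subseq (w : nat -> nat) : exists s : nat -> nat,
  {homo s : i j / (i < j)%N} /\ {homo w \o s : i j / (i <= j)%N}.
Proof.
have /choice[b bP] : forall a, exists c,
    (a <= c)%N /\ forall d, (a <= d)%N -> (w c <= w d)%N.
  move=> a; have ex : exists x, `[< exists2 c, (a <= c)%N & w c = x >].
    by exists (w a); apply/asboolP; exists a.
  have [x /asboolP[c ac <-] xmin] := ex_minnP ex.
  by exists c; split=> // d ad; apply: xmin; apply/asboolP; exists d.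
pose s k := iter k (b \o S) (b 0%N).
have s_lt k : (s k < s k.+1)%N by case: (bP (s k).+1).
exists s; split; first exact: homo_ltn ltn_trans s_lt.
apply: (homo_leq leqnn leq_trans) => k /=.
case: k => [|k]; first by case: (bP 0%N) => _; apply.
by case: (bP (s k).+1) => _; apply; rewrite (leq_trans (s_lt k)) // ltnW.
Qed.

(* Dickson's lemma *)
Lemma multinom_good n (u : nat -> multinom n) :
  exists i j, (i < j)%N /\ lem (u i) (u j).
Proof.
(* The sequence is thinned for one coordinate at a time; passing to a further subsequence keeps the
   coordinates already monotone. *)
suff H (s : seq 'I_n) : exists t : nat -> nat, {homo t : i j / (i < j)%N} /\
    forall i, i \in s ->
      {homo (fun k => fun_of_multinom (u (t k)) i) : k l / (k <= l)%N}.
  have [t [t_lt tP]] := H (enum 'I_n).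
  exists (t 0%N), (t 1%N); split; first exact: t_lt.
  by apply/mnm_lepP => i; apply: tP; rewrite ?mem_enum.
elim: s => [|i s [t [t_lt tP]]]; first by exists id; split.
have [t' [t'_lt t'P]] :=
  nondecreasing_subseq (fun k => fun_of_multinom (u (t k)) i).
exists (t \o t'); split=> [k l kl|j]; first by apply: t_lt; exact: t'_lt.
rewrite inE => /orP[/eqP-> //|js k l kl /=].
apply: tP => //; move: kl; rewrite leq_eqVlt => /orP[/eqP->//|/t'_lt].
exact: ltnW.
Qed.

Lemma mpoly_min_mlead (K : nzRingType) n (P : poly_ring K n -> Prop) p : P p ->
  exists2 q, P q & forall q', P q' -> ~~ (mlead q' < mlead q)%O.
Proof.
move: {2}(mlead p) (erefl (mlead p)) => m; move: m p.
apply: ltmwf => m IH p pm Pp.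
have [[q Pq qm]|noq] := pselect (exists2 q, P q & (mlead q < m)%O).
  exact: (IH (mlead q) qm q).
exists p => // q' Pq'; apply/negP; rewrite pm => q'm.
by apply: noq; exists q'.
Qed.

(* With J_k the ideal generated by f_0, ..., f_(k-1), take h_k of minimal     *)
(* leading monomial in f_k + J_k: if the leading monomial of h_i divides that *)
(* of h_k for some i < k, then h_k can be reduced further unless h_k = 0.     *)
Lemma mpoly_noetherian (K : fieldType) n : noetherian (poly_ring K n).
Proof.
move=> f; pose J k (p : poly_ring K n) :=
  exists q : nat -> poly_ring K n, p = \sum_(i < k) q i * f i.
have J0 k : J k 0.
  by exists (fun=> 0); rewrite big1 // => i _; rewrite mul0r.
have JD k a b c : J k a -> J k b -> J k (a + c * b).
  move=> [q ->] [q' ->]; exists (fun i => q i + c * q' i).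
  rewrite mulr_sumr -big_split; apply: eq_bigr => i _ /=.
  by rewrite mulrDl mulrA.
have JN k a : J k a -> J k (- a).
  by move=> /(JD k 0 a (-1) (J0 k)); rewrite add0r mulN1r.
have JS k l a : (k <= l)%N -> J k a -> J l a.
  move=> kl [q ->]; exists (fun i => if (i < k)%N then q i else 0).
  rewrite (big_ord_widen l (fun i => q i * f i) kl) big_mkcond.
  by apply: eq_bigr => i _; case: ifP; rewrite ?mul0r.
have Jf k : J k.+1 (f k).
  exists (fun i => (i == k)%:R); rewrite big_ord_recr /= eqxx mul1r big1 ?add0r//.
  by move=> i _; rewrite (ltn_eqF (ltn_ord i)) mul0r.
have [//|noJ] := pselect (exists k, J k (f k)); exfalso.
have /choice[h hP] : forall k, exists h, J k (f k - h) /\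
    forall h', J k (f k - h') -> ~~ (mlead h' < mlead h)%O.
  move=> k; have [|h] := @mpoly_min_mlead K n (fun h => J k (f k - h)) (f k).
    by rewrite subrr.
  by exists h.
have h0 k : h k != 0.
  apply/eqP => hk; apply: noJ; exists k.
  by case: (hP k); rewrite hk subr0.
have [i [k [ik le_ik]]] := multinom_good (fun k => mlead (h k)).
have [Jk kmin] := hP k; have [Ji _] := hP i.
have Jhi : J k (h i).
  have := JD i.+1 (f i) (f i - h i) (-1) (Jf i) (JS _ _ _ (leqnSn i) Ji).
  by rewrite mulN1r opprB addrC subrK; apply: JS.
(* The multiple [b] of [h i] cancels the leading term of [h k], and [h k - b] stays in [f k + J k],
   against minimality. *)
pose m := mnm_sub (mlead (h k)) (mlead (h i)).
have mE : mnm_add m (mlead (h i)) = mlead (h k) by apply: submK.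
pose c := mcoeff (mlead (h k)) (h k) / mcoeff (mlead (h i)) (h i).
have c0 : c != 0 by rewrite mulf_neq0 ?invr_eq0 ?mleadc_eq0.
have X0 : c *: mpolyX K m != 0 :> poly_ring K n.
  by rewrite -mleadc_eq0 mleadZ // mcoeffZ mleadXm mcoeffX eqxx mulr1.
pose b : poly_ring K n := c *: mpolyX K m * h i.
have bE : mlead b = mlead (h k) by rewrite mleadM // mleadZ // mleadXm.
pose d := h k - b.
have Jd : J k (f k - d).
  by rewrite opprB addrCA addrC; apply: JD.
have dk : mcoeff (mlead (h k)) d = 0.
  have aE : mlead (c *: mpolyX K m : poly_ring K n) = m.
    by rewrite mleadZ // mleadXm.
  have -> : mcoeff (mlead (h k)) d = mcoeff (mlead (h k)) (h k) -
      mcoeff (mnm_add (mlead (c *: mpolyX K m : poly_ring K n)) (mlead (h i))) b.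
    by rewrite aE mE mcoeffB.
  rewrite mleadcM aE mcoeffZ mcoeffX eqxx mulr1 divfK ?subrr //.
  by rewrite mleadc_eq0.
have d0 : d != 0.
  apply/eqP => d0; apply: noJ; exists k; move: Jd.
  by rewrite d0 subr0.
move/negP: (kmin d Jd); apply; rewrite lt_neqAle; apply/andP; split.
  by apply: contra_neq d0 => dl; apply/eqP; rewrite -mleadc_eq0 dl dk.
by apply: le_trans (mleadB_le _ _) _; rewrite bE joinxx.
Qed.

End Noetherian.

(** * Powers of the maximal ideal of a rational point *)

Section MaximalIdealPowers.
Context (K : fieldType) (r : nat) (p0 : 'I_r -> K).
Local Notation A := (poly_ring K r).
Local Notation X j := (mpolyX K (mnm1 j) : A).

Definition centred (j : 'I_r) : A := X j - mpolyC r (p0 j).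

Lemma meval_centred p j : meval p (centred j) = p j - p0 j.
Proof. by rewrite mevalB mevalXU mevalC. Qed.

(** The n-th power of the maximal ideal of [p0]; splitting off one generator at a time suits
    induction on n. *)
Fixpoint max_pow (n : nat) : set A :=
  if n is n'.+1 then
    [set F | exists2 G : 'I_r -> A, forall j, max_pow n' (G j) &
      F = \sum_j centred j * G j]
  else setT.

Lemma max_pow0 n : max_pow n 0.
Proof.
elim: n => //= n IH; exists (fun=> 0) => //.
by rewrite big1 // => j _; rewrite mulr0.
Qed.

Lemma max_powMD n a F G : max_pow n F -> max_pow n G -> max_pow n (F + a * G).
Proof.
elim: n a F G => //= n IH a F G [f fn ->] [g gn ->].
exists (fun j => f j + a * g j) => [j|]; first exact: IH.
rewrite mulr_sumr -big_split; apply: eq_bigr => j _ /=.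
by rewrite mulrDr mulrCA.
Qed.

Lemma max_powD n F G : max_pow n F -> max_pow n G -> max_pow n (F + G).
Proof. by move=> nF /(max_powMD 1 nF); rewrite mul1r. Qed.

Lemma max_powMl n a F : max_pow n F -> max_pow n (a * F).
Proof. by move=> /(max_powMD a (max_pow0 n)); rewrite add0r. Qed.

Lemma max_powN n F : max_pow n F -> max_pow n (- F).
Proof. by rewrite -mulN1r; apply: max_powMl. Qed.

Lemma max_pow_sum n I (s : seq I) (F : I -> A) :
  (forall i, max_pow n (F i)) -> max_pow n (\sum_(i <- s) F i).
Proof. by move=> nF; apply: big_ind => //; [exact: max_pow0 | exact: max_powD]. Qed.

Lemma max_powM m n F G :
  max_pow m F -> max_pow n G -> max_pow (m + n) (F * G).
Proof.
elim: m F => [|m IH] F /=; first by move=> _; apply: max_powMl.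
move=> [f fm ->] nG; exists (fun j => f j * G) => [j|]; first exact: IH.
by rewrite mulr_suml; apply: eq_bigr => j _; rewrite mulrA.
Qed.

Lemma max_powW n F : max_pow n.+1 F -> max_pow n F.
Proof.
move=> /= [f fn ->]; apply: max_pow_sum => j; exact: max_powMl.
Qed.

Lemma max_pow_centred j : max_pow 1 (centred j).
Proof.
exists (fun i => (i == j)%:R) => //; rewrite (bigD1 j) //= eqxx mulr1 big1 ?addr0//.
by move=> i /negbTE ->; rewrite mulr0.
Qed.

Definition gradient (f : A) (j : 'I_r) := meval p0 (mderiv j f).

Lemma gradientC d j : gradient (mpolyC r d) j = 0.
Proof. by rewrite /gradient mderivC meval0. Qed.

Lemma gradientX i j : gradient (X i) j = (i == j)%:R.
Proof.
rewrite /gradient mderivX mnm1E; case: eqP => [->|_]; last by rewrite scale0r meval0.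
have mm0 : mnm_sub (mnm1 j) (mnm1 j) = mnm0 by rewrite -{1}[mnm1 j]add0m addmK.
by rewrite scale1r mm0 mpolyX0 meval1.
Qed.

Lemma gradientD f g j : gradient (f + g) j = gradient f j + gradient g j.
Proof. by rewrite /gradient mderivD mevalD. Qed.

Lemma gradientM f g j : gradient (f * g) j =
  meval p0 g * gradient f j + meval p0 f * gradient g j.
Proof. by rewrite /gradient mderivM mevalD !mevalM mulrC. Qed.

(** The claim is clear for constants and variables, additive, and passes to products by the Leibniz
    rule. *)
Lemma taylor f : max_pow 2 (f - mpolyC r (meval p0 f) -
  \sum_j mpolyC r (gradient f j) * centred j).
Proof.
have lin1 (d : 'I_r -> K) : max_pow 1 (\sum_j mpolyC r (d j) * centred j).
  by apply: max_pow_sum => j; apply/max_powMl/max_pow_centred.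
elim/mpoly_ring_ind: f => [c|i|f g If Ig|f g If Ig].
- rewrite mevalC subrr sub0r big1 ?oppr0; first exact: max_pow0.
  by move=> j _; rewrite gradientC mpolyC0 mul0r.
- rewrite (bigD1 i) //= gradientX eqxx big1 => [|j].
    rewrite mevalXU mpolyC1 mul1r addr0 -/(centred i) subrr.
    exact: (max_pow0 2).
  by rewrite gradientX eq_sym => /negbTE ->; rewrite mpolyC0 mul0r.
- have -> : \sum_j mpolyC r (gradient (f + g) j) * centred j =
      \sum_j mpolyC r (gradient f j) * centred j +
      \sum_j mpolyC r (gradient g j) * centred j.
    rewrite -big_split; apply: eq_bigr => j _.
    by rewrite gradientD mpolyCD mulrDl.
  rewrite mevalD mpolyCD.
  have H (a b c d : A) : f + g - (a + b) - (c + d) = f - a - c + (g - b - d).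
    by ring.
  by rewrite H; apply: max_powD.
- set f1 := \sum_j _ in If; set g1 := \sum_j _ in Ig.
  have Ig' : max_pow 1 (g - mpolyC r (meval p0 g)).
    by rewrite -[_ - _](subrK g1); apply/max_powD/lin1/max_powW.
  have -> : \sum_j mpolyC r (gradient (f * g) j) * centred j =
      f1 * mpolyC r (meval p0 g) + mpolyC r (meval p0 f) * g1.
    rewrite mulr_suml mulr_sumr -big_split; apply: eq_bigr => j _ /=.
    by rewrite gradientM mpolyCD !mpolyCM; ring.
  rewrite mevalM mpolyCM.
  (* Multiples of two remainders of order two, plus [f1 * (g - b)], a product of two terms of order
     one. *)
  have H (a b : A) : f * g - a * b - (f1 * b + a * g1) =
    g * (f - a - f1) + a * (g - b - g1) + f1 * (g - b) by ring.
  rewrite H; apply: max_powD; first by apply: max_powD; apply: max_powMl.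
  exact: max_powM (lin1 _) Ig'.
Qed.

(* Perdry's proof of Krull's intersection theorem, with homogeneous           *)
(* polynomials replaced by the Rees algebra: write s = rho F_n with F_n in    *)
(* the n-th power and lift F_n t^n to P_n along K[T, X] -> K[T][t],           *)
(* X_j |-> (T_j - p0_j) t. As P_k = sum_(i < k) Q_i P_i for some k, comparing *)
(* coefficients of t^k gives the claim.                                       *)
Lemma krull (S : pzRingType) (rho : {rmorphism A -> S}) (s : S) :
  (forall n, exists F, max_pow n F /\ rho F = s) ->
  exists2 E : A, meval p0 E = 0 & s = rho E * s.
Proof.
move=> /choice[F FP].
have nF n := (FP n).1; have rhoF n := (FP n).2.
pose h (i : 'I_(r + r)) : {poly A} :=
  match split i with inl j => (X j)%:P | inr j => centred j *: 'X end.
have [E [EC EX]] := mpoly_lift (polyC \o @mpolyC r K) h.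
have [u [uC uX]] := mpoly_lift (@mpolyC (r + r) K)
  (fun j : 'I_r => mpolyX K (mnm1 (lshift r j))).
have Eu G : E (u G) = G%:P.
  elim/mpoly_ring_ind: G => [c|j|f g fE gE|f g fE gE].
  - by rewrite uC EC.
  - by rewrite uX EX /h (unsplitK (inl j)).
  - by rewrite (rmorphD u) (rmorphD E) fE gE polyCD.
  - by rewrite (rmorphM u) (rmorphM E) fE gE polyCM.
have Esurj n G : max_pow n G -> exists P, E P = G *: 'X^n.
  elim: n G => [|n IH] G /=.
    by move=> _; exists (u G); rewrite Eu expr0 alg_polyC.
  move=> [g gn ->]; have /choice[P EP] : forall j, exists P, E P = g j *: 'X^n.
    by move=> j; apply: IH.
  exists (\sum_j mpolyX K (mnm1 (rshift r j)) * P j).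
  rewrite rmorph_sum scaler_suml; apply: eq_bigr => j _.
  rewrite (rmorphM E) EP EX /h (unsplitK (inr j)).
  by rewrite -scalerAl -scalerAr scalerA exprS.
(* At [p0] every T_j - p0_j becomes 0, so the image of [E] becomes constant in t. *)
have E0 P k : (0 < k)%N -> meval p0 (E P)`_k = 0.
  move=> k0; suff [c Ec] : exists c, map_poly (meval p0) (E P) = c%:P.
    by rewrite -(coef_map (meval p0)) Ec coefC gtn_eqF.
  elim/mpoly_ring_ind: P => [c|i|f g [a fE] [b gE]|f g [a fE] [b gE]].
  - by rewrite EC /= map_polyC; eexists.
  - rewrite EX /h; case: split => j; first by rewrite map_polyC; eexists.
    exists 0; rewrite -mul_polyC rmorphM /= map_polyC /= meval_centred subrr.
    by rewrite mul0r.
  - by exists (a + b); rewrite (rmorphD E) rmorphD /= fE gE polyCD.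
  - by exists (a * b); rewrite (rmorphM E) rmorphM /= fE gE polyCM.
have /choice[P EP] : forall n, exists P, E P = F n *: 'X^n.
  by move=> n; apply: Esurj.
have [k [q Pk]] := mpoly_noetherian P.
have Fk : F k = \sum_(i < k) (E (q i))`_(k - i) * F i.
  move: (congr1 (fun P => (E P)`_k) Pk).
  rewrite EP coefZ coefXn eqxx mulr1 => ->.
  rewrite rmorph_sum coef_sum; apply: eq_bigr => i _.
  by rewrite (rmorphM E) EP -scalerAr coefZ coefMXn ltnNge ltnW //= mulrC.
exists (\sum_(i < k) (E (q i))`_(k - i)).
  rewrite (raddf_sum (meval p0)) big1 // => i _ /=.
  by rewrite E0 // subn_gt0.
rewrite -[LHS](rhoF k) Fk !rmorph_sum mulr_suml; apply: eq_bigr => i _.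
by rewrite rmorphM rhoF.
Qed.

End MaximalIdealPowers.

(** * Leading forms modulo the ideal of the equations *)

Section LeadingForm.
Context (K : fieldType) (r c : nat) (p0 : 'I_r -> K).
Local Notation A := (poly_ring K r).
Context (g : 'I_c -> A) (B : 'M[K]_(r, c)).
Hypothesis g0 : forall k, meval p0 (g k) = 0.
Local Notation J := (\matrix_(k < c, j < r) meval p0 (mderiv j (g k))).

Definition ideal_of : set A :=
  [set F | exists q : 'I_c -> A, F = \sum_k q k * g k].

Lemma ideal_ofMD a F G : ideal_of F -> ideal_of G -> ideal_of (F + a * G).
Proof.
move=> [p ->] [q ->]; exists (fun k => p k + a * q k).
rewrite mulr_sumr -big_split; apply: eq_bigr => j _ /=.
by rewrite mulrDl mulrA.
Qed.

(** The ideal (g) + m^n, for m the maximal ideal of [p0]: the preimage of the n-th power of the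
    maximal ideal in K[T]/(g). *)
Definition ideal_max_pow n : set A :=
  [set F | exists2 G, ideal_of G & max_pow p0 n (F - G)].

Lemma ideal_max_powMD n a F G : ideal_max_pow n F -> ideal_max_pow n G ->
  ideal_max_pow n (F + a * G).
Proof.
move=> [f fI Ff] [h hI Gh]; exists (f + a * h); first exact: ideal_ofMD.
have -> : F + a * G - (f + a * h) = (F - f) + a * (G - h) by ring.
exact: max_powMD.
Qed.

Lemma ideal_of_max_pow n F : ideal_of F -> ideal_max_pow n F.
Proof. by exists F => //; rewrite subrr; apply: max_pow0. Qed.

Lemma max_pow_ideal_max_pow n F : max_pow p0 n F -> ideal_max_pow n F.
Proof.
exists 0; last by rewrite subr0.
by exists (fun=> 0); rewrite big1 // => i _; rewrite mul0r.
Qed.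

Lemma ideal_max_powD n F G : ideal_max_pow n F -> ideal_max_pow n G ->
  ideal_max_pow n (F + G).
Proof. by move=> nF /(ideal_max_powMD 1 nF); rewrite mul1r. Qed.

Lemma ideal_max_powM m n F G :
  ideal_max_pow m F -> max_pow p0 n G -> ideal_max_pow (m + n) (F * G).
Proof.
move=> [f [q fE] Ff] nG; exists (f * G); last by rewrite -mulrBl; apply: max_powM.
exists (fun k => q k * G); rewrite fE mulr_suml.
by apply: eq_bigr => k _; rewrite mulrAC.
Qed.

Lemma ideal_max_pow_sum n I (s : seq I) (F : I -> A) :
  (forall i, ideal_max_pow n (F i)) -> ideal_max_pow n (\sum_(i <- s) F i).
Proof.
move=> nF; apply: big_ind => //; last exact: ideal_max_powD.
exact/max_pow_ideal_max_pow/max_pow0.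
Qed.

(* The projection of T - p0 onto the tangent space ker J along the image of B *)
Definition tangent_coord (i : 'I_r) : A :=
  \sum_j mpolyC r ((1%:M - B *m J) i j) * centred p0 j.

Lemma max_pow_tangent_coord i : max_pow p0 1 (tangent_coord i).
Proof. by apply: max_pow_sum => j; apply/max_powMl/max_pow_centred. Qed.

(** The difference is the i-th entry of B J (T - p0), and by [taylor] the entries of J (T - p0)
    agree with the [g k] up to order two. *)
Lemma centred_tangent_coord i :
  ideal_max_pow 2 (centred p0 i - tangent_coord i).
Proof.
exists (\sum_k mpolyC r (B i k) * g k); first by exists (fun k => mpolyC r (B i k)).
have -> : centred p0 i - tangent_coord i =
    \sum_k mpolyC r (B i k) * \sum_j mpolyC r (gradient p0 (g k) j) * centred p0 j.
  rewrite /tangent_coord.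
  under eq_bigr do rewrite mxE mpolyCD mulrDl.
  rewrite big_split /= opprD addrA (bigD1 i) //= mxE eqxx mpolyC1 mul1r big1 => [|j].
    rewrite addr0 subrr sub0r -sumrN.
    under [LHS]eq_bigr do rewrite !mxE mpolyCN mulNr opprK raddf_sum mulr_suml.
    rewrite exchange_big; apply: eq_bigr => k _ /=.
    rewrite mulr_sumr; apply: eq_bigr => j _.
    by rewrite mxE mpolyCM mulrA.
  by rewrite mxE eq_sym => /negbTE ->; rewrite mpolyC0 mul0r.
rewrite -sumrB; apply: max_pow_sum => k; rewrite -mulrBr; apply: max_powMl.
rewrite -opprB; apply: max_powN.
by move: (taylor p0 (g k)); rewrite g0 mpolyC0 subr0.
Qed.

(** Replacing each factor T_j - p0_j by its tangent coordinate costs only terms in (g) and terms of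
    order n+1. The result is a form of degree n in the tangent coordinates, of which only the
    homogeneity is recorded. *)
Lemma leading_form n F : max_pow p0 n F ->
  exists h : A, [/\ ideal_max_pow n.+1 (F - h), max_pow p0 n h &
    forall p q t,
      (forall i, meval p (tangent_coord i) = t * meval q (tangent_coord i)) ->
      meval p h = t ^+ n * meval q h].
Proof.
elim: n F => [|n IH] F /=.
  move=> _; exists (mpolyC r (meval p0 F)); split=> // [|p q t _].
    apply: max_pow_ideal_max_pow.
    rewrite -[_ - _](subrK (\sum_j mpolyC r (gradient p0 F j) * centred p0 j)).
    apply: max_powD; first exact/max_powW/taylor.
    by apply: max_pow_sum => j; apply/max_powMl/max_pow_centred.
  by rewrite !mevalC expr0 mul1r.
move=> [f fn ->]; have /choice[h hP] := fun j => IH (f j) (fn j).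
exists (\sum_j tangent_coord j * h j); split.
- rewrite -sumrB; apply: ideal_max_pow_sum => j.
  have -> : centred p0 j * f j - tangent_coord j * h j =
    (f j - h j) * centred p0 j + (centred p0 j - tangent_coord j) * h j by ring.
  have [fh nh _] := hP j; apply: ideal_max_powD.
    by rewrite -addn1; apply: ideal_max_powM => //; apply: max_pow_centred.
  by rewrite -add2n; apply: ideal_max_powM => //; apply: centred_tangent_coord.
- apply: (max_pow_sum (n := n.+1)) => j; rewrite -add1n.
  by apply: max_powM; [apply: max_pow_tangent_coord | case: (hP j)].
- move=> p q t pq; rewrite !raddf_sum mulr_sumr; apply: eq_bigr => j _ /=.
  rewrite !mevalM pq; have [_ _ /(_ p q t pq) ->] := hP j.
  by rewrite exprS; ring.
Qed.

End LeadingForm.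

(** * Polynomials over valued fields *)

(** For u > 0, Bernoulli's inequality makes the powers of u^-1 unbounded. *)
Lemma expr_small (R : archiRealFieldType) (u e : R) : 0 <= u < 1 -> 0 < e ->
  exists n, u ^+ n < e.
Proof.
move=> /andP[u0 u1] e0; have [->|u_neq0] := eqVneq u 0.
  by exists 1%N; rewrite expr1.
have {u_neq0}u0 : 0 < u by rewrite lt_neqAle eq_sym u_neq0.
have bern n : 1 + n%:R * (u^-1 - 1) <= u^-1 ^+ n.
  elim: n => [|n IH]; first by rewrite mul0r addr0 expr0.
  have a0 : 0 <= u^-1 - 1 by rewrite subr_ge0 invf_ge1 // ltW.
  rewrite exprS; apply: le_trans (ler_wpM2l _ IH); last by rewrite invr_ge0 ltW.
  rewrite -natr1 -subr_ge0.
  set a := u^-1 - 1; rewrite (_ : _ - _ = n%:R * (a * a)); last by rewrite /a; ring.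
  by rewrite !mulr_ge0.
have a0 : 0 < u^-1 - 1 by rewrite subr_gt0 invf_gt1.
pose n := Num.bound (e^-1 / (u^-1 - 1)); exists n.
rewrite -[e]invrK -[u ^+ n]invrK ltf_pV2 ?posrE ?invr_gt0 ?exprn_gt0 //.
rewrite -exprVn; apply: lt_le_trans (bern n).
have : e^-1 / (u^-1 - 1) < n%:R by apply: archi_boundP; rewrite divr_ge0 ?invr_ge0 ?ltW.
by rewrite ltr_pdivrMr // => /lt_trans; apply; rewrite ltrDr.
Qed.

Section ValuedField.
Context (R : realType) (K : fieldType) (v : absolute_value R K).

Lemma absval0 : v 0 = 0.
Proof. by rewrite absval_eq0. Qed.

Lemma absval_gt0 x : x != 0 -> 0 < v x.
Proof.
move=> x0; rewrite lt_neqAle absval_ge0 andbT eq_sym.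
by apply: contra_neq x0 => /absval_eq0.
Qed.

Lemma absval1 : v 1 = 1.
Proof.
have v1 : v 1 != 0 by rewrite gt_eqF // absval_gt0 // oner_neq0.
by apply: (mulfI v1); rewrite -absvalM !mulr1.
Qed.

Lemma absvalN x : v (- x) = v x.
Proof.
suff vN1 : v (-1) = 1 by rewrite -mulN1r absvalM vN1 mul1r.
apply/eqP; rewrite -[_ == _](@eqrXn2 _ 2) ?absval_ge0 //.
by rewrite expr2 -absvalM mulN1r opprK absval1 expr1n.
Qed.

Lemma absval_distC x y : v (x - y) = v (y - x).
Proof. by rewrite -absvalN opprB. Qed.

Lemma absvalX x n : v (x ^+ n) = v x ^+ n.
Proof.
by elim: n => [|n IH]; rewrite ?expr0 ?absval1 // !exprS absvalM IH.
Qed.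

Lemma absvalV x : v x^-1 = (v x)^-1.
Proof.
have [->|x0] := eqVneq x 0; first by rewrite invr0 absval0 invr0.
have vx : v x != 0 by rewrite gt_eqF ?absval_gt0.
by apply: (mulfI vx); rewrite -absvalM !divff // absval1.
Qed.

Lemma absval_sum I (s : seq I) (F : I -> K) :
  v (\sum_(i <- s) F i) <= \sum_(i <- s) v (F i).
Proof.
elim/big_rec2: _ => [|i x y _ IH]; first by rewrite absval0.
by apply: le_trans (absvalD _ _ _) _; rewrite lerD2l.
Qed.

Lemma absval_lin (I : finType) (d : I -> K) : exists2 C, 0 < C &
  forall (M : R) w, 0 <= M -> (forall i, v (w i) <= M) ->
    v (\sum_i d i * w i) <= C * M.
Proof.
(* The summand 1 keeps the constant positive even if all [d i] are 0. *)
exists (1 + \sum_i v (d i)) => [|M w M0 wM].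
  by rewrite ltr_pwDl // sumr_ge0 // => i _; apply: absval_ge0.
rewrite mulrDl mul1r; apply: le_trans (absval_sum _ _) _.
rewrite -[leLHS]add0r lerD // mulr_suml; apply: ler_sum => i _.
by rewrite absvalM ler_wpM2l ?absval_ge0.
Qed.

Lemma absval_eq0_le x : (forall e : R, 0 < e -> v x <= e) -> x = 0.
Proof.
move=> xe; have [//|x0] := eqVneq x 0; have vx := absval_gt0 x0.
have {}xe : v x <= v x / 2 by apply: xe; rewrite divr_gt0.
by exfalso; lra.
Qed.

(** Take powers of [x], or of its inverse if [v x > 1]. *)
Lemma absval_small : av_nontrivial v -> forall e : R, 0 < e ->
  exists2 t : K, t != 0 & v t < e.
Proof.
move=> [x [x0 vx]] e e0; have vx0 := absval_gt0 x0.
wlog vx1 : x x0 vx vx0 / v x < 1.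
  move=> H; case: (ltgtP (v x) 1) => vx1; first exact: (H x).
    apply: (H x^-1); rewrite ?invr_eq0 ?absvalV ?invr_gt0 ?invf_lt1 //.
    by rewrite invr_eq1.
  by rewrite vx1 eqxx in vx.
have [|n xn] := @expr_small R (v x) e _ e0; first by rewrite ltW.
by exists (x ^+ n); rewrite ?expf_neq0 // absvalX.
Qed.

(** The powers of an x with 0 < v x < 1 are distinct, which gives too many roots. *)
Lemma nontrivial_infinite : av_nontrivial v ->
  forall p : {poly K}, (forall t, p.[t] = 0) -> p = 0.
Proof.
move=> v_nt p p0; have [//|p_neq0] := eqVneq p 0.
have [x x0 vx1] := absval_small v_nt ltr01.
pose s := [seq x ^+ i | i <- iota 0 (size p)].
have us : uniq s.
  rewrite map_inj_uniq ?iota_uniq // => i j /(congr1 v); rewrite !absvalX.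
  by apply: ieexprIn; rewrite ?absval_gt0 ?lt_eqF.
have rs : all (root p) s by apply/allP => t _; apply/rootP.
by have := max_poly_roots p_neq0 rs us; rewrite size_map size_iota ltnn.
Qed.

Section PolynomialEstimates.
Context (r : nat) (p0 : 'I_r -> K).
Local Notation A := (poly_ring K r).

Lemma meval_bounded (F : A) : exists2 C : R, 0 < C &
  forall p, (forall j, v (p j - p0 j) <= 1) -> v (meval p F) <= C.
Proof.
elim/mpoly_ring_ind: F => [c|i|f g [a a0 fa] [b b0 gb]|f g [a a0 fa] [b b0 gb]].
- exists (1 + v c) => [|p _]; first by rewrite ltr_pwDl ?absval_ge0.
  by rewrite mevalC lerDr.
- exists (1 + v (p0 i)) => [|p pp]; first by rewrite ltr_pwDl ?absval_ge0.
  rewrite mevalXU -[p i](subrK (p0 i)); apply: le_trans (absvalD _ _ _) _.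
  by rewrite lerD2r.
- exists (a + b) => [|p pp]; first exact: addr_gt0.
  by rewrite mevalD; apply: le_trans (absvalD _ _ _) _; rewrite lerD ?fa ?gb.
- exists (a * b) => [|p pp]; first exact: mulr_gt0.
  by rewrite mevalM absvalM ler_pM ?absval_ge0 ?fa ?gb.
Qed.

(** Each of the n factors T_j - p0_j contributes one factor [M]. *)
Lemma max_pow_bounded n (F : A) : max_pow p0 n F -> exists2 C : R, 0 < C &
  forall p M, 0 <= M <= 1 -> (forall j, v (p j - p0 j) <= M) ->
    v (meval p F) <= C * M ^+ n.
Proof.
elim: n F => [|n IH] F /=.
  have [C C0 FC] := meval_bounded F; exists C => // p M /andP[_ M1] pM.
  by rewrite expr0 mulr1; apply: FC => j; apply: le_trans M1.
move=> [f fn ->].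
have /choice[C CP] : forall j, exists C : R, 0 < C /\
    forall p M, 0 <= M <= 1 -> (forall j, v (p j - p0 j) <= M) ->
    v (meval p (f j)) <= C * M ^+ n.
  by move=> j; have [C ? ?] := IH (f j) (fn j); exists C.
exists (1 + \sum_j C j) => [|p M M01 pM].
  by rewrite ltr_pwDl // sumr_ge0 // => j _; case: (CP j) => /ltW.
have M0 : 0 <= M by case/andP: M01.
rewrite mulrDl mul1r -[leLHS]add0r lerD ?exprn_ge0 // mulr_suml raddf_sum.
apply: le_trans (absval_sum _ _) _; apply: ler_sum => j _ /=.
rewrite mevalM meval_centred absvalM exprS mulrCA.
by rewrite ler_pM ?absval_ge0 //; case: (CP j) => _; apply.
Qed.

(** The differential is taken at the centre [p0], not at [q]: this costs an error linear in the
    radius [d], but lets Newton's method work with one fixed matrix. *)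
Lemma meval_quadratic (f : A) : exists2 C : R, 0 < C &
  forall p q d M, 0 <= d <= 1 -> 0 <= M ->
    (forall j, v (p j - p0 j) <= d) -> (forall j, v (q j - p0 j) <= d) ->
    (forall j, v (p j - q j) <= M) ->
    v (meval p f - meval q f - \sum_j gradient p0 f j * (p j - q j)) <= C * d * M.
Proof.
elim/mpoly_ring_ind: f => [c|i|f g [a a0 fa] [b b0 gb]|f g [a a0 fa] [b b0 gb]].
- exists 1 => // p q d M /andP[d0 _] M0 _ _ _; rewrite !mevalC subrr sub0r absvalN.
  rewrite big1 ?absval0 ?mulr_ge0 // => j _.
  by rewrite gradientC mul0r.
- exists 1 => // p q d M /andP[d0 _] M0 _ _ _; rewrite !mevalXU.
  suff -> : \sum_j gradient p0 (mpolyX K (mnm1 i)) j * (p j - q j) = p i - q i.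
    by rewrite subrr absval0 ?mulr_ge0.
  rewrite (bigD1 i) //= gradientX eqxx mul1r big1 ?addr0 // => j.
  by rewrite gradientX eq_sym => /negbTE ->; rewrite mul0r.
- exists (a + b) => [|p q d M d01 M0 pd qd pq]; first exact: addr_gt0.
  have -> : \sum_j gradient p0 (f + g) j * (p j - q j) =
      \sum_j gradient p0 f j * (p j - q j) + \sum_j gradient p0 g j * (p j - q j).
    rewrite -big_split; apply: eq_bigr => j _.
    by rewrite gradientD mulrDl.
  rewrite !mevalD mulrDl mulrDl; have H (x y z t s u : K) :
    x + y - (z + t) - (s + u) = (x - z - s) + (y - t - u) by ring.
  rewrite H; apply: le_trans (absvalD _ _ _) _.
  by rewrite lerD ?fa ?gb.
- have [Cf Cf0 fb] := meval_bounded f; have [Cg Cg0 gB] := meval_bounded g.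
  have [Lf Lf0 fL] := absval_lin (gradient p0 f).
  have [Lg Lg0 gL] := absval_lin (gradient p0 g).
  have lip (h : A) : exists2 C : R, 0 < C & forall p d, 0 <= d <= 1 ->
      (forall j, v (p j - p0 j) <= d) -> v (meval p h - meval p0 h) <= C * d.
    have [|C C0 hC] := @max_pow_bounded 1 (h - mpolyC r (meval p0 h)).
      rewrite -[_ - _](subrK (\sum_j mpolyC r (gradient p0 h j) * centred p0 j)).
      apply: max_powD; first exact/max_powW/taylor.
      by apply: max_pow_sum => j; apply/max_powMl/max_pow_centred.
    exists C => // p d d01 pd; rewrite -[d]expr1.
    by have := hC p d d01 pd; rewrite mevalB mevalC.
  have [Df Df0 fD] := lip f; have [Dg Dg0 gD] := lip g.
  exists (Cg * a + Cf * b + Lf * Dg + Lg * Df) => [|p q d M d01 M0 pd qd pq].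
    by rewrite !addr_gt0 ?mulr_gt0.
  have /andP[d0 d1] := d01.
  have -> : \sum_j gradient p0 (f * g) j * (p j - q j) =
      meval p0 g * \sum_j gradient p0 f j * (p j - q j) +
      meval p0 f * \sum_j gradient p0 g j * (p j - q j).
    rewrite !mulr_sumr -big_split; apply: eq_bigr => j _ /=.
    by rewrite gradientM mulrDl !mulrA.
  have := fa p q d M d01 M0 pd qd pq; have := gb p q d M d01 M0 pd qd pq.
  have := fL M (fun j => p j - q j) M0 pq.
  have := gL M (fun j => p j - q j) M0 pq.
  set x := \sum_j _; set y := \sum_j _ => xM yM gM fM.
  (* A discrete Leibniz rule: the errors of the two factors, and those of replacing values at [p]
     and [q] by values at [p0]. *)
  have H : meval p (f * g) - meval q (f * g) - (meval p0 g * y + meval p0 f * x) =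
    meval p g * (meval p f - meval q f - y) +
    meval q f * (meval p g - meval q g - x) +
    y * (meval p g - meval p0 g) + x * (meval q f - meval p0 f).
    by rewrite !mevalM; ring.
  have le1 s : (forall j, v (s j - p0 j) <= d) -> forall j, v (s j - p0 j) <= 1.
    by move=> sd j; apply: le_trans d1.
  have vM (s t : K) (S T : R) : v s <= S -> v t <= T -> v (s * t) <= S * T.
    by move=> sS tT; rewrite absvalM ler_pM ?absval_ge0.
  have -> : (Cg * a + Cf * b + Lf * Dg + Lg * Df) * d * M =
    Cg * (a * d * M) + Cf * (b * d * M) + (Lf * M) * (Dg * d) +
    (Lg * M) * (Df * d) by ring.
  rewrite H.
  apply: le_trans (absvalD _ _ _) (lerD _ (vM _ _ _ _ xM (fD q d d01 qd))).
  apply: le_trans (absvalD _ _ _) (lerD _ (vM _ _ _ _ yM (gD p d d01 pd))).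
  apply: le_trans (absvalD _ _ _) (lerD _ (vM _ _ _ _ (fb q (le1 q qd)) gM)).
  exact: vM (gB p (le1 p pd)) fM.
Qed.

End PolynomialEstimates.
End ValuedField.

(** * Newton's method *)

Lemma common_bound (R : realType) (I : finType) (P : I -> R -> Prop) :
  (forall i, exists C, P i C) ->
  (forall i C C', C <= C' -> P i C -> P i C') ->
  exists2 C, 1 <= C & forall i, P i C.
Proof.
move=> /choice[C PC] Pm; exists (1 + \sum_i `|C i|) => [|i].
  by rewrite lerDl sumr_ge0.
apply: Pm (PC i); rewrite (bigD1 i) //= addrCA -[C i]addr0 lerD ?ler_norm //.
  by rewrite addr0 ler_norm.
by rewrite addr_ge0 // sumr_ge0.
Qed.

Section Newton.
Context (R : realType) (K : fieldType) (v : absolute_value R K).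
Local Notation w n := ((2^-1 : R) ^+ n).

Lemma geometric_cauchy (s : nat -> K) a :
  (forall n, v (s n.+1 - s n) <= a * w n) -> av_cauchy v s.
Proof.
move=> sa e e0.
have a0 : 0 <= a by have := sa 0%N; rewrite mulr1; apply/le_trans/absval_ge0.
(* The bounds telescope, as w n = 2 (w n - w n.+1). *)
have sS n d : v (s (n + d)%N - s n) <= 2 * a * (w n - w (n + d)%N).
  elim: d => [|d IH]; first by rewrite addn0 !subrr absval0 mulr0.
  rewrite addnS -(subrK (s (n + d)%N) (s _)) -addrA.
  apply: le_trans (absvalD _ _ _) (le_trans (lerD (sa _) IH) _).
  by rewrite exprS; lra.
(* Two tails of size 2 a w N give the 4 a; the 1 keeps the divisor positive. *)
have [||N wN] := @expr_small R 2^-1 (e / (4 * a + 1)).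
- by rewrite invr_ge0 invf_lt1 ?ler0n ?ltr0n // ltr1n.
- by rewrite divr_gt0 // ltr_wpDl // mulr_ge0.
have sN n : (N <= n)%N -> v (s n - s N) <= 2 * a * w N.
  move=> Nn; rewrite -(subnKC Nn); apply: le_trans (sS _ _) _.
  by rewrite ler_wpM2l ?mulr_ge0 // gerBl exprn_ge0 // invr_ge0.
exists N => m n Nm Nn; rewrite -(subrK (s N) (s m)) -addrA.
apply: le_lt_trans (absvalD _ _ _) _; rewrite [v (s N - _)]absval_distC.
apply: le_lt_trans (lerD (sN _ Nm) (sN _ Nn)) _.
move: wN; rewrite ltr_pdivlMr; last by rewrite ltr_wpDl // mulr_ge0.
have : 0 <= w N by rewrite exprn_ge0 // invr_ge0.
by move: (w N) => x x0; nra.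
Qed.

Lemma meval_lipschitz r (p0 : 'I_r -> K) (f : poly_ring K r) :
  exists2 C : R, 0 < C & forall p q M, 0 <= M ->
    (forall j, v (p j - p0 j) <= 1) -> (forall j, v (q j - p0 j) <= 1) ->
    (forall j, v (p j - q j) <= M) -> v (meval p f - meval q f) <= C * M.
Proof.
have [C C0 CP] := meval_quadratic v p0 f.
have [D D0 DP] := absval_lin v (gradient p0 f).
exists (C + D) => [|p q M M0 p1 q1 pq]; first exact: addr_gt0.
rewrite -[_ - _](subrK (\sum_j gradient p0 f j * (p j - q j))) mulrDl.
apply: le_trans (absvalD _ _ _) (lerD _ _); last exact: DP.
by rewrite -[C]mulr1; apply: CP => //; rewrite ler01 lexx.
Qed.

Context (v_complete : av_complete v) (r c : nat) (p0 : 'I_r -> K).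
Context (g : 'I_c -> poly_ring K r) (B : 'M[K]_(r, c)).
Hypothesis g0 : forall k, meval p0 (g k) = 0.
Local Notation J := (\matrix_(k < c, j < r) meval p0 (mderiv j (g k))).
Hypothesis JB : J *m B = 1%:M.
Local Notation Pr := (1%:M - B *m J).

Let PrB : Pr *m B = 0.
Proof. by rewrite mulmxBl mul1mx -mulmxA JB mulmx1 subrr. Qed.

Let JPr : J *m Pr = 0.
Proof. by rewrite mulmxBr mulmx1 mulmxA JB mul1mx subrr. Qed.

Lemma meval_tangent_coord p i :
  meval p (tangent_coord p0 g B i) = (Pr *m \col_j (p j - p0 j)) i 0.
Proof.
rewrite raddf_sum mxE; apply: eq_bigr => j _ /=.
by rewrite mevalM mevalC meval_centred [(\col__ _) _ _]mxE.
Qed.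

(* Simplified Newton iteration u |-> u - B g(p0 + u) from t Y(q): as J B = 1, *)
(* the residuals decay geometrically, and as (1 - B J) B = 0, the tangent     *)
(* coordinates do not move.                                                   *)
Lemma zeros_along q : exists T : R, exists2 eta : R, 0 < eta &
  forall t, v t < eta -> exists p : 'I_r -> K,
    [/\ forall k, meval p (g k) = 0,
        forall i, meval p (tangent_coord p0 g B i) =
          t * meval q (tangent_coord p0 g B i) &
        forall j, v (p j - p0 j) <= T * v t].
Proof.
have [C C1 CP] : exists2 C : R, 1 <= C & forall k p p' d M,
    0 <= d <= 1 -> 0 <= M ->
    (forall j, v (p j - p0 j) <= d) -> (forall j, v (p' j - p0 j) <= d) ->
    (forall j, v (p j - p' j) <= M) ->
    v (meval p (g k) - meval p' (g k) -
       \sum_j gradient p0 (g k) j * (p j - p' j)) <= C * d * M.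
  apply: common_bound => [k|k C C' CC' CP p p' d M /andP[d0 d1] M0 pd pd' pp'].
    by have [C _ CP] := meval_quadratic v p0 (g k); exists C.
  apply: le_trans (CP _ _ _ _ _ M0 pd pd' pp') _; first exact/andP.
  by rewrite !ler_wpM2r.
have [b b1 bP] : exists2 b : R, 1 <= b & forall i (y : 'cV_c) M, 0 <= M ->
    (forall k, v (y k 0) <= M) -> v ((B *m y) i 0) <= b * M.
  apply: common_bound => [i|i b b' bb' bP y M M0 yM].
    have [b _ bP] := absval_lin v (B i); exists b => y M M0 yM.
    by rewrite mxE; apply: bP.
  by apply: le_trans (bP _ _ M0 yM) _; rewrite ler_wpM2r.
set tau := Pr *m \col_j (q j - p0 j).
pose T := 1 + \sum_i v (tau i 0).
have T1 : 1 <= T by rewrite lerDl sumr_ge0 // => i _; apply: absval_ge0.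
have T0 : 0 < T by apply: lt_le_trans T1.
have C0 : 0 < C by apply: lt_le_trans C1.
have b0 : 0 < b by apply: lt_le_trans b1.
have tauT i : v (tau i 0) <= T.
  rewrite /T (bigD1 i) //= addrCA lerDl addr_ge0 // sumr_ge0 // => j _.
  exact: absval_ge0.
(* The iteration will stay in the ball of radius d = 2 T v t; this bound on [v t] makes the
   contraction ratio C b d at most 1/2. *)
exists (2 * T), (4 * T * C * b)^-1; first by rewrite invr_gt0 !mulr_gt0.
move=> t; rewrite -[_^-1]mul1r ltr_pdivlMr ?mulr_gt0 // => t_small.
pose M := T * v t; pose d := 2 * M.
have vt0 : 0 <= v t by apply: absval_ge0.
have M0 : 0 <= M by rewrite mulr_ge0 // ltW.
have d0 : 0 <= d by rewrite mulr_ge0.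
have Cbd : C * b * d <= 2^-1 by rewrite /d /M; lra.
have Cb1 : 1 <= C * b by rewrite -[1]mulr1 ler_pM.
have d01 : 0 <= d <= 1 by apply/andP; split=> //; nra.
have w0 n : 0 <= w n by rewrite exprn_ge0 // invr_ge0.
pose at_ (u : 'cV[K]_r) j := p0 j + u j 0.
pose G (u : 'cV[K]_r) := \col_k meval (at_ u) (g k).
have atB u j : at_ u j - p0 j = u j 0 by rewrite addrC addKr.
have atBB u u' j : at_ u j - at_ u' j = (u - u') j 0.
  by rewrite !mxE opprD addrACA subrr add0r.
have gradE u u' k :
    \sum_j gradient p0 (g k) j * (at_ u j - at_ u' j) = (J *m (u - u')) k 0.
  by rewrite mxE; apply: eq_bigr => j _; rewrite atBB [J _ _]mxE.
pose u n := iter n (fun u => u - B *m G u) (t *: tau).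
have uS n : u n.+1 = u n - B *m G (u n) by [].
have uSB n : u n.+1 - u n = - (B *m G (u n)) by rewrite uS addrAC subrr add0r.
pose m := C * d * M.
have m0 : 0 <= m by rewrite !mulr_ge0 // ltW.
have bm : b * m <= M / 2 by rewrite /m; nra.
(* The start has size at most M and the corrections at most M/2, M/4, ..., so the iterates stay
   within d = 2 M. *)
have inv n : (forall i, v (u n i 0) <= d - M * w n) /\
    (forall k, v (G (u n) k 0) <= m * w n).
  elim: n => [|n [un Gn]].
    have u0 i : v (u 0%N i 0) <= M by rewrite mxE absvalM mulrC ler_wpM2r.
    split=> [i|k]; rewrite expr0 !mulr1.
      by apply: le_trans (u0 i) _; rewrite /d; lra.
    (* As J tau = 0 and g vanishes at [p0], the first residual is a purely quadratic error. *)
    have := CP k (at_ (u 0%N)) (at_ 0) d M d01 M0.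
    rewrite gradE subr0 /= -scalemxAr mulmxA JPr mul0mx scaler0 [(0 : 'cV_c) k 0]mxE subr0.
    have at0 : at_ 0 =1 p0 by move=> j; rewrite /at_ mxE addr0.
    rewrite (meval_eq _ at0) g0 subr0 [G _ _ _]mxE; apply=> j.
    - by rewrite atB; apply: le_trans (u0 j) _; rewrite /d; lra.
    - by rewrite atB mxE absval0.
    - by rewrite atBB subr0.
  have un_d i : v (u n i 0) <= d.
    by apply: le_trans (un i) _; rewrite gerBl mulr_ge0.
  have Bn i : v ((B *m G (u n)) i 0) <= b * (m * w n).
    by apply: bP Gn; rewrite mulr_ge0.
  have step i : v (u n.+1 i 0) <= d - M * w n.+1.
    rewrite uS mxE; apply: le_trans (absvalD _ _ _) (le_trans (lerD (un i) _) _).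
      by rewrite mxE absvalN; apply: Bn.
    by have := w0 n; rewrite exprS; move: (w n) => x x0; nra.
  split=> // k.
  have bmw : 0 <= b * (m * w n) by rewrite !mulr_ge0 // ltW.
  (* Since J B = 1, the linear part of the correction cancels the old residual; only the quadratic
     error remains. *)
  have := CP k (at_ (u n.+1)) (at_ (u n)) d (b * (m * w n)) d01 bmw.
  rewrite gradE uSB mulmxN mulmxA JB mul1mx.
  rewrite [(- G _) _ _]mxE opprK [G (u n) _ _]mxE subrK => H.
  rewrite [G _ _ _]mxE; apply: le_trans (H _ _ _) _ => [j|j|j|].
  - rewrite atB; apply: le_trans (step j) _.
    by rewrite gerBl mulr_ge0.
  - by rewrite atB.
  - by rewrite atBB uSB mxE absvalN.
  - rewrite exprS [m * (_ * _)]mulrCA.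
    rewrite (_ : C * d * _ = C * b * d * (m * w n)); last by ring.
    by rewrite ler_wpM2r // mulr_ge0.
have u_near n i : v (u n i 0) <= d.
  have [/(_ i) ui _] := inv n; apply: le_trans ui _.
  by rewrite gerBl mulr_ge0.
have PrU n : Pr *m u n = t *: tau.
  elim: n => [|n IH].
    rewrite /= -scalemxAr mulmxA mulmxBr mulmx1 mulmxA.
    by rewrite PrB mul0mx subr0.
  by rewrite uS mulmxBr IH mulmxA PrB mul0mx subr0.
have /choice[l lP] : forall i, exists l, av_converges v (fun n => u n i 0) l.
  move=> i; apply/v_complete/(@geometric_cauchy _ (b * m)) => n.
  have -> : u n.+1 i 0 - u n i 0 = - (B *m G (u n)) i 0.
    by rewrite uS mxE addrAC subrr add0r mxE.
  rewrite absvalN -mulrA; have [_ Gn] := inv n.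
  by apply: bP Gn; rewrite mulr_ge0.
have approx e : 0 < e ->
    exists n, (forall i, v (l i - u n i 0) <= e) /\ w n <= e.
  move=> e0; have /choice[N NP] : forall i, exists N, forall n, (N <= n)%N ->
      v (l i - u n i 0) <= e.
    move=> i; have [N NP] := lP i e e0; exists N => n /NP.
    by rewrite absval_distC => /ltW.
  have [|N' wN] := @expr_small R 2^-1 e _ e0.
    by rewrite invr_ge0 invf_lt1 ?ler0n ?ltr0n // ltr1n.
  exists (maxn N' (\max_i N i)); split=> [i|].
    by apply: NP; rewrite leq_max orbC (leq_bigmax_cond (P := xpredT)).
  apply: le_trans (ltW wN); apply: ler_wiXn2l; rewrite ?leq_maxl ?invr_ge0 //.
  by rewrite invf_le1 // ler1n.
have l_near i : v (l i) <= d.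
  apply/ler_addgt0Pr => e /approx[n [ln _]].
  rewrite -[l i](subrK (u n i 0)) addrC.
  exact: le_trans (absvalD _ _ _) (lerD (u_near n i) (ln i)).
exists (fun j => p0 j + l j); split.
(* The value at the limit is bounded by a Lipschitz constant times the distance to an iterate, plus
   the residual of that iterate. *)
- move=> k; apply: (absval_eq0_le (v := v)) => e e0.
  have [L L0 LP] := meval_lipschitz p0 (g k).
  have Lm : 0 < L + m by rewrite ltr_pwDl.
  have [|n [ln wn]] := approx (e / (L + m)); first by rewrite divr_gt0.
  set p := fun j => _; rewrite -[meval p _](subrK (meval (at_ (u n)) (g k))).
  apply: le_trans (absvalD _ _ _) _.
  have -> : e = L * (e / (L + m)) + m * (e / (L + m)).
    by rewrite -mulrDl mulrC divfK // gt_eqF.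
  have /andP[_ d1] := d01.
  apply: lerD.
    apply: LP => [|j|j|j]; first by rewrite divr_ge0 ?ltW.
    - by rewrite /p addrAC subrr add0r; apply: le_trans d1.
    - by rewrite atB; apply: le_trans d1.
    - by rewrite /p /at_ opprD addrACA subrr add0r.
  have [_ /(_ k)] := inv n; rewrite mxE => /le_trans; apply.
  by rewrite ler_wpM2l.
- move=> i; rewrite !meval_tangent_coord; apply/eqP; rewrite -subr_eq0.
  apply/eqP/(absval_eq0_le (v := v)) => e e0.
  have [L L0 LP] := absval_lin v (Pr i).
  have [|n [ln wn]] := approx (e / L); first by rewrite divr_gt0.
  have -> : (Pr *m \col_j (p0 j + l j - p0 j)) i 0 - t * tau i 0 =
      \sum_j Pr i j * (l j - u n j 0).
    have -> : t * tau i 0 = (Pr *m u n) i 0 by rewrite PrU [(t *: tau) i 0]mxE.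
    rewrite mxE [(Pr *m u n) i 0]mxE -sumrB; apply: eq_bigr => j _.
    by rewrite [(\col__ _) _ _]mxE addrAC subrr add0r mulrBr.
  apply: le_trans (LP (e / L) _ _ ln) _; first by rewrite divr_ge0 // ltW.
  by rewrite mulrC divfK // gt_eqF.
- by move=> j; rewrite addrAC subrr add0r -mulrA; apply: l_near.
Qed.

End Newton.

(** * Smooth rational points of affine schemes *)

Lemma rmorphism_of (A S : pzRingType) (f : A -> S) :
  {morph f : x y / x + y} -> {morph f : x y / x * y} -> f 1 = 1 ->
  exists F : {rmorphism A -> S}, F =1 f.
Proof.
move=> fD fM f1.
have f0 : f 0 = 0 by apply: (addrI (f 0)); rewrite -fD !addr0.
have fB : zmod_morphism f.
  by move=> x y; apply: (addIr (f y)); rewrite subrK -fD subrK.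
pose F : {rmorphism A -> S} := HB.pack f
  (GRing.isZmodMorphism.Build A S f fB)
  (GRing.isMonoidMorphism.Build A S f (conj f1 fM)).
by exists F.
Qed.

Section Presentation.
Context (K : fieldType) (A : comPzRingType) (i : {rmorphism K -> A}).
Context (r : nat) (a : 'I_r -> A).

Lemma peval_rmorphism : (1 : A) <> 0 ->
  exists rho : {rmorphism poly_ring K r -> A},
    [/\ rho =1 peval i a, forall c, rho (mpolyC r c) = i c &
        forall j, rho (mpolyX K (mnm1 j)) = a j].
Proof.
move=> /eqP A1; pose A' : comNzRingType :=
  HB.pack (GRing.ComPzRing.sort A) (GRing.PzSemiRing_isNonZero.Build A A1).
pose rho : {rmorphism poly_ring K r -> A'} :=
  mmap (i : {rmorphism K -> A'}) (a : 'I_r -> A').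
exists rho; split=> // [c|j]; first by rewrite /rho /= mmapC.
by rewrite /rho /= mmapX mmap1U.
Qed.

Lemma rmorph_peval (L : comPzRingType) (chi : {rmorphism A -> L}) F :
  chi (peval i a F) = \sum_(m <- msupp F)
    chi (i (mcoeff m F)) * \prod_j chi (a j) ^+ fun_of_multinom m j.
Proof.
rewrite rmorph_sum; apply: eq_bigr => m _ /=.
by rewrite rmorphM rmorph_prod; congr (_ * _); apply: eq_bigr => j _; rewrite rmorphXn.
Qed.

Context (c : nat) (g : 'I_c -> poly_ring K r).
Hypothesis A1 : (1 : A) <> 0.
Hypothesis pres : is_presentation i a g.

(** Evaluation at a common zero kills (g), hence factors through [A]; its values are computed on
    chosen lifts [l]. *)
Lemma zero_rmorphism p : (forall k, meval p (g k) = 0) ->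
  exists chi : {rmorphism A -> K}, [/\ forall F, chi (peval i a F) = meval p F,
    forall c, chi (i c) = c & forall j, chi (a j) = p j].
Proof.
move=> gp; have [rho [rhoE rhoC rhoX]] := peval_rmorphism A1; have [gen ker] := pres.
have {ker}ker F : rho F = 0 -> meval p F = 0.
  rewrite rhoE => /ker[q ->]; rewrite raddf_sum big1 // => k _ /=.
  by rewrite mevalM gp mulr0.
have /choice[l lP] := gen.
have lE F : meval p (l (rho F)) = meval p F.
  apply/eqP; rewrite -subr_eq0 -mevalB; apply/eqP/ker.
  by rewrite rmorphB [rho (l _)]rhoE lP subrr.
have {}lP s : s = rho (l s) by rewrite rhoE lP.
have [|||chi chiE] := @rmorphism_of A K (fun s => meval p (l s)).
- by move=> x y; rewrite [in LHS](lP x) [in LHS](lP y) -rmorphD lE mevalD.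
- by move=> x y; rewrite [in LHS](lP x) [in LHS](lP y) -rmorphM lE mevalM.
- by rewrite -(rmorph1 rho) lE meval1.
have {}chiE F : chi (peval i a F) = meval p F by rewrite chiE -rhoE lE.
exists chi; split=> // [d|j].
  by rewrite -rhoC rhoE chiE mevalC.
by rewrite -rhoX rhoE chiE mevalXU.
Qed.

End Presentation.

(** * Functions vanishing near a smooth point *)

Section SmoothPoint.
Context (R : realType) (K : fieldType) (v : absolute_value R K).
Context (v_nontrivial : av_nontrivial v) (v_complete : av_complete v).
Context (r c : nat) (p0 : 'I_r -> K) (g : 'I_c -> poly_ring K r).
Hypothesis g0 : forall k, meval p0 (g k) = 0.
Hypothesis g_smooth :
  row_free (\matrix_(k < c, j < r) meval p0 (mderiv j (g k))).

(* Inductively S = G + F with G in (g) and F of order n. On the zeros p of g  *)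
(* with tangent coordinates t Y(q), the leading form h of F is t^n h(q),      *)
(* while F - h = O(t^(n+1)) and F vanishes: letting t -> 0, h(q) = 0.         *)
Lemma vanishing_ideal_max_pow (S : poly_ring K r) e : 0 < e ->
  (forall p, (forall j, v (p j - p0 j) < e) ->
     (forall k, meval p (g k) = 0) -> meval p S = 0) ->
  forall n, ideal_max_pow p0 g n S.
Proof.
have /row_freeP[B JB] := g_smooth.
move=> e0 S0; elim=> [|n [G GI SG]]; first exact: max_pow_ideal_max_pow.
have [h [[G' GI' hG'] nh h_hom]] := leading_form B g0 SG.
suff h0 : h = 0.
  rewrite -(subrK G S) -[X in _ + X]mul1r; apply: ideal_max_powMD.
    by exists G' => //; rewrite -[S - G]subr0 -h0.
  exact: ideal_of_max_pow.
apply: (mpoly_eq0 (nontrivial_infinite v_nontrivial)) => q.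
have [T [eta eta0 zeros]] := zeros_along v_complete (B := B) g0 JB q.
have [C C0 CP] := max_pow_bounded v hG'.
pose T' := 1 + `|T|.
have T'0 : 0 < T' by rewrite ltr_pwDl.
have ideal0 p F : ideal_of g F -> (forall k, meval p (g k) = 0) -> meval p F = 0.
  move=> [f ->] gp; rewrite raddf_sum big1 // => k _ /=.
  by rewrite mevalM gp mulr0.
apply: (absval_eq0_le (v := v)) => d d0.
pose D := C * T' ^+ n.+1.
have D0 : 0 < D by rewrite mulr_gt0 // exprn_gt0.
(* The four bounds give, in turn, the zero [p], the inequality T' v t <= 1, the distance [e], and
   the target [d]. *)
have [|t t0] := absval_small v_nontrivial
    (e := Num.min (Num.min eta (T'^-1)) (Num.min (e / T') (d / D))).
  by rewrite !lt_min eta0 invr_gt0 T'0 !divr_gt0.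
rewrite !lt_min => /andP[/andP[t_eta t_T] /andP[t_e t_d]].
have [p [gp pq pT]] := zeros t t_eta.
have vt0 := absval_gt0 v t0.
have {}pT j : v (p j - p0 j) <= T' * v t.
  apply: le_trans (pT j) _; rewrite ler_wpM2r ?absval_ge0 //.
  by apply: le_trans (ler_norm _) _; rewrite lerDr.
have Sp : meval p S = 0.
  by apply: S0 => // j; apply: le_lt_trans (pT j) _; rewrite mulrC -ltr_pdivlMr.
have : v (meval p (S - G - h - G')) <= C * (T' * v t) ^+ n.+1.
  apply: CP pT; apply/andP; split; first by rewrite mulr_ge0 ?ltW.
  by rewrite mulrC -ler_pdivlMr // div1r ltW.
rewrite !mevalB Sp (ideal0 p G) // (ideal0 p G') // !subr0 sub0r absvalN.
(* Cancelling (v t)^n leaves v (h(q)) <= D v t < d. *)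
rewrite (h_hom p q t pq) absvalM absvalX exprMn mulrA -/D exprS.
rewrite [v t * _]mulrC mulrA [D * _]mulrC -mulrA ler_pM2l ?exprn_gt0 //.
move=> /le_trans; apply; apply: ltW.
by rewrite mulrC -ltr_pdivlMr.
Qed.

(** Otherwise a lift of [s] lies in (g) + m^n for all n, and [krull] gives (1 - E) s = 0 with E(p0)
    = 0. The factor 1 - E has value 1 at [p0], so it is nonzero and s = 0. *)
Lemma nonvanishing_zero (A : comPzRingType) (i : {rmorphism K -> A})
    (a : 'I_r -> A) (s : A) e :
  is_domain A -> is_presentation i a g -> s <> 0 -> 0 < e ->
  exists p : 'I_r -> K, (forall j, v (p j - p0 j) < e) /\
    exists chi : {rmorphism A -> K},
      [/\ forall d, chi (i d) = d, forall j, chi (a j) = p j & chi s <> 0].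
Proof.
move=> [A1 A_dom] pres s0 e0.
have [rho [rhoE _ _]] := peval_rmorphism i a A1.
have [gen ker] := pres.
have [S SE] := gen s.
apply: contrapT => no_zero; apply: s0.
have S_ideal : forall n, ideal_max_pow p0 g n S.
  apply: (vanishing_ideal_max_pow e0) => p pe gp.
  have [chi [chiE chiC chiX]] := zero_rmorphism A1 pres gp.
  apply/eqP/negPn/negP => /eqP Sp; apply: no_zero; exists p; split=> //.
  by exists chi; split=> //; rewrite -SE chiE.
have [|E E0 sE] := @krull K r p0 A rho s.
  move=> n; have [G /ker Gker nSG] := S_ideal n.
  by exists (S - G); split=> //; rewrite rmorphB !rhoE SE Gker subr0.
have [chi [chiE _ _]] := zero_rmorphism A1 pres g0.
have /A_dom[E1|//] : (1 - rho E) * s = 0 by rewrite mulrBl mul1r -sE subrr.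
have := congr1 chi E1; rewrite rmorphB rmorph0 rmorph1 rhoE chiE E0 subr0.
by move=> /eqP; rewrite oner_eq0.
Qed.

End SmoothPoint.

(** * Points and sections of schemes *)

Section LinearIndependence.
Context (K L : fieldType) (iota : {rmorphism K -> L}).

Definition lin_indep n (e : 'I_n -> L) := forall d : 'I_n -> K,
  \sum_j iota (d j) * e j = 0 -> forall j, d j = 0.

(** An element of the list joins the family only if it is not yet in the span. *)
Lemma lin_indep_span (cs : seq L) : exists n (e : 'I_n -> L), lin_indep e /\
  forall x, x \in cs -> exists d : 'I_n -> K, x = \sum_j iota (d j) * e j.
Proof.
elim: cs => [|x cs [n [e [e_indep eP]]]].
  by exists 0%N, (fun=> 0); split=> // d _ [].
have [x_span|x_span] :=
  pselect (exists d : 'I_n -> K, x = \sum_j iota (d j) * e j).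
  by exists n, e; split=> // y; rewrite inE => /orP[/eqP->//|/eP].
exists n.+1, (fun j => if unlift ord0 j is Some k then e k else x).
split=> [d|y].
  rewrite big_ord_recl unlift_none; under eq_bigr do rewrite liftK.
  move=> de; have d0 : d ord0 = 0.
    have [//|d0] := eqVneq (d ord0) 0; exfalso; apply: x_span.
    exists (fun j => - (d ord0)^-1 * d (lift ord0 j)).
    have i0 : iota (d ord0) != 0 by rewrite fmorph_eq0.
    apply: (mulfI i0); rewrite mulr_sumr.
    move/eqP: de; rewrite addr_eq0 => /eqP ->; rewrite -sumrN.
    apply: eq_bigr => j _; rewrite rmorphM rmorphN fmorphV.
    by rewrite !mulrA mulrN divff // mulN1r mulNr.
  move: de; rewrite d0 rmorph0 mul0r add0r => /e_indep de j.
  by case: (unliftP ord0 j) => [k ->|->].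
rewrite inE => /orP[/eqP->|/eP[d ->]].
  exists (fun j => (j == ord0)%:R); rewrite big_ord_recl unlift_none eqxx.
  by rewrite rmorph1 mul1r big1 ?addr0 // => j _; rewrite rmorph0 mul0r.
exists (fun j => if unlift ord0 j is Some k then d k else 0).
rewrite big_ord_recl unlift_none rmorph0 mul0r add0r.
by apply: eq_bigr => j _; rewrite liftK.
Qed.

(** The coefficients of [f] are expanded in independent [e j], and the part at [e j] is collected in
    [phi j]. The same [phi j] serve every [psi], so points over L and over K can be compared. *)
Lemma meval_lin_indep (A : comPzRingType) (i : {rmorphism K -> A})
    r (b : 'I_r -> A) (f : poly_ring L r) :
  exists n (e : 'I_n -> L) (phi : 'I_n -> A), lin_indep e /\
    forall psi : {rmorphism A -> L}, (forall c, psi (i c) = iota c) ->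
      meval (fun j => psi (b j)) f = \sum_j psi (phi j) * e j.
Proof.
have [n [e [e_indep eP]]] :=
  lin_indep_span [seq mcoeff m f | m <- msupp f].
have /choice[d dP] : forall m, exists d : 'I_n -> K, m \in msupp f ->
    mcoeff m f = \sum_j iota (d j) * e j.
  move=> m; have [mf|_] := boolP (m \in msupp f); last by exists (fun=> 0).
  by have [d ->] := eP _ (map_f (fun m => mcoeff m f) mf); exists d.
exists n, e, (fun j => \sum_(m <- msupp f)
  i (d m j) * \prod_k b k ^+ fun_of_multinom m k); split=> // psi psiE.
under [RHS]eq_bigr do rewrite rmorph_sum mulr_suml.
rewrite exchange_big mevalE; apply: eq_big_seq => m mf.
rewrite [in LHS](dP m mf) mulr_suml; apply: eq_bigr => j _.
rewrite rmorphM psiE rmorph_prod mulrAC; congr (_ * _ * _).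
by apply: eq_bigr => k _; rewrite rmorphXn.
Qed.

End LinearIndependence.

(** * Irreducibility of integral schemes *)

Section Opens.
Context (X : topologicalType).

Definition opens_meet (U V : opens X) : opens X :=
  Opens (openI (open_setP U) (open_setP V)).

Definition opens_join (U V : opens X) : opens X :=
  Opens (openU (open_setP U) (open_setP V)).

Lemma opens_meet_l (U V : opens X) : opens_meet U V `<=` U.
Proof. by move=> x []. Qed.

Lemma opens_meet_r (U V : opens X) : opens_meet U V `<=` V.
Proof. by move=> x []. Qed.

Lemma opens_join_l (U V : opens X) : U `<=` opens_join U V.
Proof. by left. Qed.

Lemma opens_join_r (U V : opens X) : V `<=` opens_join U V.
Proof. by right. Qed.

End Opens.

Section Irreducible.
Context (K : fieldType) (W : ringed_space K).

(** The empty family covers [O], and gluing along it is unique. *)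
Lemma sec_empty (O : opens W) (s t : rs_sec O) : O `<=` set0 -> s = t.
Proof.
move=> O0; have [||u [_ uP]] := @rs_glue K W O False (fun f => match f with end)
    (fun f => match f with end) (fun f => match f with end).
- by move=> x /O0.
- by case.
by rewrite -(uP s) ?(uP t) // => -[].
Qed.

Lemma glue_disjoint (U V : opens W) (s : rs_sec U) (t : rs_sec V) :
  opens_meet U V `<=` set0 ->
  exists! u : rs_sec (opens_join U V),
    rs_res (@opens_join_l _ U V) u = s /\ rs_res (@opens_join_r _ U V) u = t.
Proof.
move=> UV0; pose T b : opens W := if b then U else V.
have TU b : T b `<=` opens_join U V.
  by case: b => x Tx; [left | right].
pose st b : rs_sec (T b) := match b with true => s | false => t end.
have [||u [uP u_uniq]] := @rs_glue K W (opens_join U V) bool T TU st.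
- by move=> x [Ux|Vx]; [exists true | exists false].
- move=> i j O; move: i j => [] [] Oi Oj.
  + by rewrite (Prop_irrelevance Oi Oj).
  + by apply: sec_empty => x Ox; apply: UV0; split; [exact: Oi | exact: Oj].
  + by apply: sec_empty => x Ox; apply: UV0; split; [exact: Oj | exact: Oi].
  + by rewrite (Prop_irrelevance Oi Oj).
have E (u' : rs_sec (opens_join U V)) :
    (forall b, rs_res (TU b) u' = st b) <->
    rs_res (@opens_join_l _ U V) u' = s /\ rs_res (@opens_join_r _ U V) u' = t.
  rewrite -(Prop_irrelevance (TU true) (@opens_join_l _ U V)).
  rewrite -(Prop_irrelevance (TU false) (@opens_join_r _ U V)).
  by split=> [H|[Hs Ht] []//]; rewrite (H true) (H false).
by exists u; split=> [|u' /E]; [exact/E | exact: u_uniq].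
Qed.

End Irreducible.

(** On a disjoint union the sections (1,0) and (0,1) would be zero divisors. *)
Lemma integral_meet (K : fieldType) (W : scheme K) (U V : opens W) :
  integral_scheme W -> U !=set0 -> V !=set0 -> U `&` V !=set0.
Proof.
move=> [_ W_dom] U0 V0; have [//|UV0] := pselect (U `&` V !=set0); exfalso.
have {}UV0 : opens_meet U V `<=` set0 by move=> x UVx; apply: UV0; exists x.
have [u [[uU uV] _]] := glue_disjoint (1 : rs_sec U) (0 : rs_sec V) UV0.
have [w [[wU wV] _]] := glue_disjoint (0 : rs_sec U) (1 : rs_sec V) UV0.
have [z [_ z_uniq]] := glue_disjoint (0 : rs_sec U) (0 : rs_sec V) UV0.
have uw0 : u * w = 0.
  rewrite -(z_uniq (u * w)); last first.
    by rewrite !rmorphM uU uV wU wV mulr0 mul0r.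
  by apply: z_uniq; rewrite !rmorph0.
have [_ dom] : is_domain (rs_sec (opens_join U V)).
  by apply: W_dom; have [x Ux] := U0; exists x; left.
have [u0|w0] := dom _ _ uw0.
  have [U1 _] := W_dom U U0; apply: U1.
  by rewrite -uU u0 rmorph0.
have [V1 _] := W_dom V V0; apply: V1.
by rewrite -wV w0 rmorph0.
Qed.

(** * Points of an affine open set from ring homomorphisms *)

Section AffineOpen.
Context (K : fieldType) (W : scheme K) (U : opens W).
Local Notation A := (rs_sec U).
Context (phi : W -> set A).
Hypothesis phi_surj : forall P, prime_ideal P -> exists2 x, U x & phi x = P.
Hypothesis phi_open : forall V : set W, V `<=` U ->
  (open V <-> exists S : set A, V = [set x | U x /\ exists2 s, S s & ~ phi x s]).
Hypothesis phi_loc : forall (s : A) (V : opens W) (VU : V `<=` U),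
  V = [set x | U x /\ ~ phi x s] :> set W -> is_localization s (rs_res VU).

Lemma basic_open (s : A) : exists2 V : opens W, V `<=` U &
  V = [set x | U x /\ ~ phi x s] :> set W.
Proof.
have sU : [set x | U x /\ ~ phi x s] `<=` U by move=> x [].
have sO : open [set x | U x /\ ~ phi x s].
  apply/(phi_open sU); exists [set s]; apply/seteqP; split=> x [Ux xs].
    by split=> //; exists s.
  by have [t -> ?] := xs.
by exists (Opens sO).
Qed.

Lemma basic_open_base (V : opens W) x : U x -> V x ->
  exists2 s : A, ~ phi x s & [set y | U y /\ ~ phi y s] `<=` V.
Proof.
move=> Ux Vx; have UV : opens_meet V U `<=` U by exact: opens_meet_r.
have [S SE] := (phi_open UV).1 (open_setP _).
have : (opens_meet V U : set W) x by [].
rewrite SE => -[_ [s Ss xs]]; exists s => // y [Uy ys].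
suff : (opens_meet V U : set W) y by case.
by rewrite SE; split=> //; exists s.
Qed.

Section PointOfMorphism.
Context (L : fieldType) (i : {rmorphism K -> L}) (chi : {rmorphism A -> L}).
Hypothesis chi_coef : forall c, chi (rs_coef U c) = i c.

Let ker_chi : set A := [set s | chi s = 0].

Lemma prime_ker : prime_ideal ker_chi.
Proof.
rewrite /ker_chi; split=> [|a b /= a0 b0|a b /= b0||a b /=].
- exact: rmorph0.
- by rewrite rmorphD a0 b0 addr0.
- by rewrite rmorphM b0 mulr0.
- by move=> /=; rewrite rmorph1 => /eqP; rewrite oner_eq0.
- by rewrite rmorphM => /eqP; rewrite mulf_eq0 => /orP[] /eqP; [left|right].
Qed.

Context (x : W) (Ux : U x) (phix : phi x = ker_chi).

(** The section dies on some D(s) around x, so s^n a = 0 by localization, while [chi s] is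
    nonzero. *)
Lemma germ_eq0 (V : opens W) (VU : V `<=` U) a : V x -> rs_res VU a = 0 ->
  chi a = 0.
Proof.
move=> Vx a0; have [s xs sV] := basic_open_base Ux Vx.
have [D DU DE] := basic_open s.
have DV : D `<=` V by rewrite DE.
have [_ _ loc] := phi_loc DU DE.
have [|n sa] := loc a; first by rewrite -(rs_res_comp VU DV DU) a0 rmorph0.
have := congr1 chi sa; rewrite rmorphM rmorph0 rmorphXn => /eqP.
rewrite mulf_eq0 expf_eq0 => /orP[/andP[_ /eqP chis]|/eqP//].
by exfalso; apply: xs; rewrite phix.
Qed.

(* The germ of tau at x is a / s. *)
Definition germ_frac (V : opens W) (tau : rs_sec V) (a s : A) :=
  exists (O : opens W) (OU : O `<=` U) (OV : O `<=` V),
    [/\ O x, chi s != 0 & rs_res OV tau * rs_res OU s = rs_res OU a].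

Lemma germ_frac_ex (V : opens W) (tau : rs_sec V) : V x ->
  exists a s, germ_frac tau a s.
Proof.
move=> Vx; have [s xs sV] := basic_open_base Ux Vx.
have [D DU DE] := basic_open s.
have DV : D `<=` V by rewrite DE.
have [_ loc _] := phi_loc DU DE.
have [a [n sa]] := loc (rs_res DV tau).
exists a, (s ^+ n), D, DU, DV; split; last by rewrite rmorphXn.
  by rewrite DE.
rewrite rmorphXn expf_neq0 //; apply/eqP => chis.
by apply: xs; rewrite phix.
Qed.

Lemma germ_frac2 (V : opens W) (tau tau' : rs_sec V) a s a' s' :
  germ_frac tau a s -> germ_frac tau' a' s' ->
  exists (O : opens W) (OU : O `<=` U) (OV : O `<=` V),
    [/\ O x, chi s != 0, chi s' != 0,
        rs_res OV tau * rs_res OU s = rs_res OU a &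
        rs_res OV tau' * rs_res OU s' = rs_res OU a'].
Proof.
move=> [O [OU [OV [Ox s0 E]]]] [O' [OU' [OV' [Ox' s0' E']]]].
pose D := opens_meet O O'.
have DO : D `<=` O := @opens_meet_l _ O O'.
have DO' : D `<=` O' := @opens_meet_r _ O O'.
have DU : D `<=` U := subset_trans DO OU.
have DV : D `<=` V := subset_trans DO OV.
exists D, DU, DV; split=> //.
  move/(congr1 (rs_res DO)): E; rewrite rmorphM.
  by rewrite (rs_res_comp _ _ DV) !(rs_res_comp _ _ DU).
move/(congr1 (rs_res DO')): E'; rewrite rmorphM.
by rewrite (rs_res_comp _ _ DV) !(rs_res_comp _ _ DU).
Qed.

Lemma germ_frac_inj (V : opens W) (tau : rs_sec V) a s a' s' :
  germ_frac tau a s -> germ_frac tau a' s' -> chi a / chi s = chi a' / chi s'.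
Proof.
move=> f f'; have [O [OU [OV [Ox s0 s0' E E']]]] := germ_frac2 f f'.
apply/eqP; rewrite eqr_div // -subr_eq0 -!rmorphM -rmorphB; apply/eqP.
apply: (germ_eq0 (VU := OU) Ox).
rewrite rmorphB !rmorphM -E -E'; apply/eqP; rewrite subr_eq0; apply/eqP; ring.
Qed.

(** This extends [chi] to germs at x; [germ_frac_inj] makes the value independent of the
    fraction. *)
Lemma germ_frac_rmorphism (V : opens W) : V x ->
  exists F : {rmorphism rs_sec V -> L}, forall tau a s,
    germ_frac tau a s -> F tau = chi a / chi s.
Proof.
move=> Vx; have /choice[f fP] : forall tau : rs_sec V, exists c : L,
    forall a s, germ_frac tau a s -> c = chi a / chi s.
  move=> tau; have [a [s as_]] := germ_frac_ex tau Vx.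
  by exists (chi a / chi s) => a' s' /(germ_frac_inj as_).
have [|||F FE] := @rmorphism_of (rs_sec V) L f; last first.
- by exists F => tau a s; rewrite FE; apply: fP.
- apply: etrans (fP 1 1 1 _) _; last by rewrite rmorph1 divr1.
  pose D := opens_meet U V; exists D, (@opens_meet_l _ U V), (@opens_meet_r _ U V).
  by rewrite !rmorph1 mulr1 oner_eq0; split.
- move=> tau tau'; have [a [s as_]] := germ_frac_ex tau Vx.
  have [a' [s' as_']] := germ_frac_ex tau' Vx.
  rewrite (fP _ _ _ as_) (fP _ _ _ as_') mulf_div -!rmorphM; apply: fP.
  have [O [OU [OV [Ox s0 s0' E E']]]] := germ_frac2 as_ as_'.
  exists O, OU, OV; split=> //; first by rewrite rmorphM mulf_neq0.
  by rewrite !rmorphM -E -E'; ring.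
- move=> tau tau'; have [a [s as_]] := germ_frac_ex tau Vx.
  have [a' [s' as_']] := germ_frac_ex tau' Vx.
  have [O [OU [OV [Ox s0 s0' E E']]]] := germ_frac2 as_ as_'.
  rewrite (fP _ _ _ as_) (fP _ _ _ as_') addf_div // -!rmorphM -rmorphD.
  apply: fP; exists O, OU, OV; split=> //; first by rewrite rmorphM mulf_neq0.
  by rewrite rmorphD rmorphD !rmorphM -E -E'; ring.
Qed.

Lemma point_at : exists y : points i W, pt y = x /\
  forall (Uy : U (pt y)) s, ev Uy s = chi s.
Proof.
pose ev_ (V : opens W) (Vx : V x) := projT1 (cid (germ_frac_rmorphism Vx)).
have evP (V : opens W) (Vx : V x) tau a s : germ_frac tau a s -> ev_ V Vx tau = chi a / chi s.
  exact: (projT2 (cid (germ_frac_rmorphism Vx))).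
have ev_coef_ (V : opens W) (Vx : V x) c : ev_ V Vx (rs_coef V c) = i c.
  rewrite (evP V Vx _ (rs_coef U c) 1) ?rmorph1 ?divr1 //.
  exists (opens_meet U V), (@opens_meet_l _ U V), (@opens_meet_r _ U V).
  by rewrite !rmorph1 mulr1 oner_eq0 !rs_res_coef; split.
have ev_res_ (V O : opens W) (OV : O `<=` V) (Vx : V x) (Ox : O x) s :
    ev_ O Ox (rs_res OV s) = ev_ V Vx s.
  have [a [t at_]] := germ_frac_ex (rs_res OV s) Ox.
  rewrite (evP _ _ _ _ _ at_); apply/esym/evP.
  have [D [DU [DO [Dx t0 E]]]] := at_.
  exists D, DU, (subset_trans DO OV); split=> //.
  by rewrite -(rs_res_comp OV DO).
have ev_local_ (V : opens W) (Vx : V x) s : ev_ V Vx s != 0 ->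
    exists (O : opens W) (OV : O `<=` V), O x /\ exists t, rs_res OV s * t = 1.
  have [a [t at_]] := germ_frac_ex s Vx.
  rewrite (evP _ _ _ _ _ at_) => ne0.
  have [O [OU [OV [Ox t0 E]]]] := at_.
  have a0 : chi a != 0 by apply: contraNneq ne0 => ->; rewrite mul0r.
  (* Near x the section [s] is a/t; as [a] is invertible on D(a), which contains x, t/a is an
     inverse of [s]. *)
  have [D DU DE] := basic_open a.
  have [[b ab] _ _] := phi_loc DU DE.
  pose P := opens_meet O D.
  have PO : P `<=` O := @opens_meet_l _ O D.
  have PD : P `<=` D := @opens_meet_r _ O D.
  have PU : P `<=` U := subset_trans PO OU.
  exists P, (subset_trans PO OV); split.
    split=> //; rewrite DE; split=> //; rewrite phix => /eqP.
    by rewrite (negbTE a0).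
  exists (rs_res PU t * rs_res PD b).
  rewrite mulrA -(rs_res_comp OV PO) -(rs_res_comp OU PO) -rmorphM E.
  rewrite (rs_res_comp OU PO PU) -(rs_res_comp DU PD PU) -rmorphM ab.
  exact: rmorph1.
exists (Point ev_coef_ ev_res_ ev_local_); split=> // Uy s.
rewrite /= (evP U Uy s s 1) ?rmorph1 ?divr1 //.
have UU : U `<=` U by [].
by exists U, UU, UU; rewrite !rmorph1 mulr1 oner_eq0; split.
Qed.

End PointOfMorphism.

(** The morphism Spec L -> U attached to [chi], located at the prime ker chi. *)
Lemma point_of_rmorphism (L : fieldType) (i : {rmorphism K -> L})
    (chi : {rmorphism A -> L}) : (forall c, chi (rs_coef U c) = i c) ->
  exists (y : points i W) (Uy : U (pt y)),
    (forall s, ev Uy s = chi s) /\ phi (pt y) = [set s | chi s = 0].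
Proof.
move=> chi_coef; have [x Ux phix] := phi_surj (prime_ker chi).
have [y [yx yP]] := point_at chi_coef Ux phix.
have Uy : U (pt y) by rewrite yx.
by exists y, Uy; split; [exact: yP | rewrite yx].
Qed.

End AffineOpen.

(* A nonzero function is nonzero on some principal open D(s) inside U, where  *)
(* the Jacobian presentation of O(U) gives zeros close to x.                  *)
Lemma smooth_nonvanishing (R : realType) (K : fieldType) (v : absolute_value R K)
    (W : scheme K) (x : analytic_points v W) (N : set (analytic_points v W))
    (V : opens W) (f : rs_sec V) :
  av_nontrivial v -> av_complete v -> integral_scheme W -> smooth_at x ->
  nbhs x N -> is_affine V -> V !=set0 -> f <> 0 ->
  exists2 y : analytic_points v W, N y &
    exists Vy : V (pt y), ev Vy f <> 0.
Proof.
move=> v_nt v_complete W_int [U [Ux [r [c [a [g [U_aff pres g_smooth]]]]]]].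
rewrite nbhsE => -[N' [oN' N'x] N'N] [psi [_ _ psi_surj psi_open psi_loc]].
move=> V0 f0; have W_dom := W_int.2.
have [D DV DE] := basic_open psi_open f.
have [[t ft] _ _] := psi_loc f D DV DE.
(* The zero ideal of the domain O(V) is prime, and its point lies in D(f). *)
have D0 : D !=set0.
  have [V1 V_dom] := W_dom V V0.
  have [|z Vz psiz] := psi_surj [set 0].
    split=> [|a' b|a' b|//|a' b /V_dom//] //=; first by move=> -> ->; exact: addr0.
    by move=> ->; exact: mulr0.
  by exists z; rewrite DE; split=> //; rewrite psiz.
have U0 : U !=set0 by exists (pt x).
have [z [Dz Uz]] := integral_meet W_int D0 U0.
have [phi [phi_prime _ phi_surj phi_open phi_loc]] := U_aff.
have [s zs sD] := basic_open_base phi_open Uz Dz.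
have s0 : s <> 0 by move=> s0; apply: zs; rewrite s0; case: (phi_prime z Uz).
have [B oB N'B] : exists2 B, av_open v B &
    forall (y : analytic_points v W) (Uy : U (pt y)), N' y <-> B (coords Uy a).
  by apply: oN'; split=> //; case: pres.
have [e e0 eB] := oB _ ((N'B x Ux).1 N'x).
have g0 k : meval (coords Ux a) (g k) = 0.
  have : peval (rs_coef U) a (g k) = 0.
    apply/pres.2; exists (fun j => (j == k)%:R).
    rewrite (bigD1 k) //= eqxx mul1r big1 ?addr0 // => j /negbTE ->.
    by rewrite mul0r.
  move=> /(congr1 (ev Ux)); rewrite rmorph_peval rmorph0 => <-.
  by rewrite mevalE; apply: eq_bigr => m _; rewrite ev_coef.
have [p [pe [chi [chiC chia chis]]]] :=
  nonvanishing_zero v_nt v_complete g0 g_smooth (W_dom U U0) pres s0 e0.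
have [y [Uy [evy phiy]]] :=
  point_of_rmorphism phi_surj phi_open phi_loc (i := idfun) chiC.
have Dy : D (pt y) by apply: sD; split=> //; rewrite phiy.
have Vy : V (pt y) := DV _ Dy.
exists y.
  by apply/N'N/(N'B y Uy)/eB => j; rewrite /coords evy chia; apply: pe.
(* On D(f) the section [f] has the inverse [t], so its value at [y] is not 0. *)
exists Vy => fy0; have := congr1 (ev Dy) ft.
rewrite rmorphM rmorph1 (ev_res DV Vy) fy0 mul0r => /eqP.
by rewrite eq_sym oner_eq0.
Qed.

Theorem theorem3p1
  (R : realType) (K : fieldType) (v : absolute_value R K)
  (v_nontrivial : av_nontrivial v) (v_complete : av_complete v)
  (Kbar : closedFieldType) (iota : {rmorphism K -> Kbar})
  (Kbar_algebraic : forall z : Kbar, algebraicOver iota z)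
  (W : scheme K) (W_finite_type : finite_type W) (W_integral : integral_scheme W)
  (W_dim : krull_dim_ge W 1)
  (x : analytic_points v W) (x_smooth : smooth_at x)
  (N : set (analytic_points v W)) (N_nbhs : nbhs x N) :
  dense ([set extend_point iota y | y in N] : set (zariski_points iota W)).
Proof.
move=> O [z Oz] oO.
have [n [U [U_cover U_chart]]] := W_finite_type.
have [k Ukz] := U_cover (pt z).
have [r [b chart]] := U_chart k.
have [B [F BE] OB] : exists2 B, zariski_open B &
    forall (y : zariski_points iota W) (Uy : U k (pt y)),
      O y <-> B (coords Uy b) := oO _ _ _ chart.
have : B (coords Ukz b) by apply/OB.
rewrite BE => -[f Ff fz].
have [m [e [phi [e_indep fE]]]] := meval_lin_indep iota (rs_coef (U k)) b f.
(* If all [phi j] were 0, then [f] would vanish at [z]. *)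
have [j phij] : exists j, phi j <> 0.
  apply: contrapT => phi0; apply: fz.
  rewrite (fE (ev Ukz)) => [|c]; last exact: ev_coef.
  rewrite big1 // => j _; have [->|/eqP pj] := eqVneq (phi j) 0.
    by rewrite rmorph0 mul0r.
  by exfalso; apply: phi0; exists j.
have Uk0 : U k !=set0 by exists (pt z).
have [y Ny [Uy yj]] := smooth_nonvanishing v_nontrivial v_complete W_integral
  x_smooth N_nbhs chart.1 Uk0 phij.
exists (extend_point iota y); split; last by exists y.
apply: (OB (extend_point iota y) Uy).2; rewrite BE; exists f => //= fy.
(* The [phi l] take values in K at [y], so f(y) = 0 is a linear relation over K between the
   [e l]. *)
apply: yj; apply: (e_indep (fun l => ev Uy (phi l))).
rewrite -[RHS]fy (fE (iota \o ev Uy)) // => c.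
by rewrite /= ev_coef.
Qed.
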